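(* Let $\overline F=e^{\phi}F$ be a proper anisotropic conformal transformation between two non-Riemannian conic pseudo-Finsler metrics $F$ and $\overline F$ on a surface $M$. Then: (i) If $F$ is a locally Minkowski metric and the transformation is a $\overline C$-anisotropic conformal change, then the two sprays $S$ and $\overline S$ are projectively equivalent if and only if $\phi_{;2,1}=0$ in some coordinate system. (ii) If $F$ is projectively flat, then the transformation is $\overline C$-anisotropic conformal if and only if $\phi_{,2}=\phi_{;2}\left[\phi_{,1}-\frac{G^k}{F^2}\ell_k\right]$. Moreover, the transformation is $C$-anisotropic conformal if and only if $\phi_{,2}=-\frac{\phi_{;2}}{F^2}G^k\ell_k$. (iii) If the property of being $C$-anisotropic conformal is preserved (i.e. the transformation is both $C$-anisotropic and $\overline C$-anisotropic conformal), then $F$ is projectively flat if and only if $\phi$ is a first integral of the geodesic spray $S$.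
   Context: $M$ is a smooth 2-dimensional manifold with local coordinates $(x^i)$ and induced coordinates $(x^i,y^i)$ on $TM$; $\partial_i=\partial/\partial x^i$, $\dot\partial_i=\partial/\partial y^i$. $\mathcal A\subset TM_0=TM\setminus(0)$ is a conic sub-bundle (non-empty, open, invariant under $y\mapsto\lambda y$, $\lambda>0$, projecting onto $M$). A function is $h(r)$ if it is positively homogeneous of degree $r$ in $y$. A conic pseudo-Finsler metric is a smooth $h(1)$ function $F:\mathcal A\to\mathbb R$ with $g_{ij}=\frac12\dot\partial_i\dot\partial_jF^2$ non-degenerate. Modified Berwald frame: $\ell_i=\dot\partial_iF$, $\ell^i=y^i/F$, $g_{ij}=\ell_i\ell_j+\varepsilon m_im_j$ with $\varepsilon=\pm1$, $m^i=g^{ij}m_j$. Spray coefficients: $G^i=\frac14g^{ik}(y^m\partial_m\dot\partial_kF^2-\partial_kF^2)$; $G^j_i=\dot\partial_iG^j$; $\delta_i=\partial_i-G^j_i\dot\partial_j$; geodesic spray $S=y^i\partial_i-2G^i\dot\partial_i$. The main scalar $\mathcal I$ is defined by $FC_{ijk}=\mathcal I m_im_jm_k$, where $C_{ijk}=\frac12\dot\partial_kg_{ij}$; $C^i_{jk}=g^{ir}C_{rjk}$; $F$ is Riemannian iff $\mathcal I=0$. For smooth $f$ on $\mathcal A$: $F\dot\partial_if=f_{;1}\ell_i+f_{;2}m_i$, $\delta_if=f_{,1}\ell_i+f_{,2}m_i$; $\phi_{;2,1}=(\phi_{;2})_{,1}$. An anisotropic conformal transformation of $F$ is $\overline F=e^{\phi(x,y)}F$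 with $\phi$ a smooth $h(0)$ function on $\mathcal A$ such that $\varepsilon+\sigma-(\phi_{;2})^2\ne0$, where $\sigma=\phi_{;2;2}+\varepsilon\mathcal I\phi_{;2}+2(\phi_{;2})^2$; $\rho=\frac{1}{\sigma+\varepsilon-(\phi_{;2})^2}$. It is proper if $\phi_{;2}\neq0$. Bars denote objects associated with $\overline F$; the frame of $\overline F$ is taken with the same sign $\varepsilon$, $\overline m_i=e^{\phi}\sqrt{\varepsilon/\rho}\,m_i$. A proper change is $C$-anisotropic conformal if $C^i_{jk}\partial_i\phi=0$, and $\overline C$-anisotropic conformal if $\overline C^i_{jk}\partial_i\phi=0$. $F$ is locally Minkowski if $G^i=0$ in some coordinate system; in (i) the coordinate expressions (including the $\overline C$-anisotropic condition) are taken in such a coordinate system. $S$ and $\overline S$ are projectively equivalent if $\overline G^i=G^i+\mathcal P y^i$ for some function $\mathcal P$. $F$ is projectively flat iff Hamel's equation $\dot\partial_1\partial_2F=\dot\partial_2\partial_1F$ holds, equivalently $G^km_k=0$ (in the coordinates used). $\phi$ is a first integral of $S$ if $S(\phi)=0$, i.e. $\phi_{,1}=0$.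
   Formalization: ''Non-Riemannian'' is taken to mean that the main scalars of F and of F̄ do not vanish identically on any non-empty open part of the domain; if they are only required not to vanish everywhere, the claim (ii) fails where the metric is Riemannian on an open part. *)

(* Defs.v *)
From HB Require Import structures.
From mathcomp Require Import all_boot all_order all_algebra.
From mathcomp Require Import all_classical all_reals all_analysis.
Set Implicit Arguments.
Unset Strict Implicit.
Unset Printing Implicit Defensive.
Import Order.TTheory GRing.Theory Num.Theory.
Import numFieldNormedType.Exports.
Local Open Scope classical_set_scope.
Local Open Scope ring_scope.

Section Smoothness.
Context {R : realType}.

Fixpoint iter_derive (V W : normedModType R) (vs : seq V) (f : V -> W) :
    V -> W :=
  if vs is v :: vs' then 'D_v (iter_derive vs' f) else f.

(* C^oo on the open set D: every iterated directional derivative is (Frechet)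
   differentiable, hence continuous, at every point of D. *)
Definition smooth_on (V W : normedModType R) (D : set V) (f : V -> W) :=
  forall (vs : seq V) (x : V), D x -> differentiable (iter_derive vs f) x.

End Smoothness.

(* A chart is total as a function; only its restriction to [dom] and the
   restriction of [chart_inv] to the image of [dom] are meaningful. *)
Record chart (R : realType) (M : topologicalType) := Chart {
  dom : set M;
  chart_coord : M -> 'rV[R]_2;
  chart_inv : 'rV[R]_2 -> M;
  dom_open : open dom;
  image_open : open (chart_coord @` dom);
  chart_coordK : forall p, dom p -> chart_inv (chart_coord p) = p;
  chart_coord_continuous : forall p, dom p -> {for p, continuous chart_coord};
  chart_inv_continuous :
    forall x, (chart_coord @` dom) x -> {for x, continuous chart_inv} }.

Section Charts.
Context {R : realType} {M : topologicalType}.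
Implicit Types c d : chart R M.

Definition chart_image c : set 'rV[R]_2 := chart_coord c @` dom c.

Definition transition c d (x : 'rV[R]_2) : 'rV[R]_2 :=
  chart_coord d (chart_inv c x).

Definition compatible c d :=
  smooth_on (chart_coord c @` (dom c `&` dom d)) (transition c d) /\
  smooth_on (chart_coord d @` (dom c `&` dom d)) (transition d c).

End Charts.

(* A smooth structure is a maximal atlas, so that "a coordinate system of M" is
   an element of [atlas]. *)
Record surface (R : realType) := Surface {
  points :> topologicalType;
  surface_hausdorff : hausdorff_space points;
  surface_second_countable : @second_countable points;
  atlas : set (chart R points);
  atlas_cover : forall p : points, exists2 c, atlas c & dom c p;
  atlas_compatible : forall c d, atlas c -> atlas d -> compatible c d;
  atlas_maximal :
    forall c, (forall d, atlas d -> compatible c d) -> atlas c }.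

(* The coordinates of a point of TM in an induced chart are (x, y) = (x^i, y^i).
   TM is given by gluing the charts (x, y) along the induced changes of
   coordinates: a subset of TM (resp. a function on it) is the family of its
   expressions in the charts of the atlas, subject to the compatibility
   conditions in [conic_subbundle] (resp. [function_on]). *)
Definition tset (R : realType) (M : topologicalType) :=
  chart R M -> set ('rV[R]_2 * 'rV[R]_2).
Definition tfun (R : realType) (M : topologicalType) :=
  chart R M -> 'rV[R]_2 * 'rV[R]_2 -> R.

Section TangentBundle.
Context {R : realType} {M : surface R}.
Local Notation TR2 := ('rV[R]_2 * 'rV[R]_2)%type.
Implicit Types (c d : chart R M) (A : tset R M) (f : tfun R M).

Definition tchange c d (v : TR2) : TR2 :=
  (transition c d v.1, 'D_(v.2) (transition c d) v.1).

Record conic_subbundle A : Prop := ConicSubbundle {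
  csb_nonempty : exists2 c, atlas c & A c !=set0;
  csb_sub : forall c v, atlas c -> A c v -> chart_image c v.1 /\ v.2 != 0;
  csb_open : forall c, atlas c -> open (A c);
  csb_conic : forall c v (lambda : R), atlas c -> 0 < lambda -> A c v ->
    A c (v.1, lambda *: v.2);
  csb_onto : forall c x, atlas c -> chart_image c x -> exists y, A c (x, y);
  csb_change : forall c d v, atlas c -> atlas d ->
    chart_image c v.1 -> dom d (chart_inv c v.1) ->
    (A c v <-> A d (tchange c d v)) }.

Definition function_on A f :=
  forall c d v, atlas c -> atlas d -> A c v -> dom d (chart_inv c v.1) ->
    f d (tchange c d v) = f c v.

Definition smooth_function_on A f :=
  function_on A f /\ forall c, atlas c -> smooth_on (A c) (f c).

(* h(r) *)
Definition homogeneous_on A (r : nat) f :=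
  forall c v (lambda : R), atlas c -> A c v -> 0 < lambda ->
    f c (v.1, lambda *: v.2) = lambda ^+ r * f c v.

End TangentBundle.

(* Local formulas in one chart; f, F, phi are functions of v = (x, y). *)
Section LocalFormulas.
Context {R : realType}.
Local Notation TR2 := ('rV[R]_2 * 'rV[R]_2)%type.
Implicit Types (f F phi : TR2 -> R) (i j k : 'I_2) (v : TR2).
Implicit Types (m : 'I_2 -> TR2 -> R) (eps : R).

Definition dx i f : TR2 -> R := 'D_((delta_mx 0 i, 0) : TR2) f.
Definition dy i f : TR2 -> R := 'D_((0, delta_mx 0 i) : TR2) f.

Definition ycomp i v : R := v.2 0 i.
Definition sqrfun F v : R := F v ^+ 2.

Definition metric F v : 'M[R]_2 :=
  \matrix_(i, j) (2^-1 * dy i (dy j (sqrfun F)) v).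
Definition metric_inv F v : 'M[R]_2 := invmx (metric F v).

(* l_i *)
Definition ell F i : TR2 -> R := dy i F.

(* C_{ijk} and C^i_{jk} *)
Definition cartan F i j k v : R := 2^-1 * dy k (fun u => metric F u i j) v.
Definition cartan_up F i j k v : R :=
  \sum_r metric_inv F v i r * cartan F r j k v.

(* G^i *)
Definition spray_coef F i v : R :=
  4^-1 * \sum_k metric_inv F v i k *
    (\sum_r ycomp r v * dx r (dy k (sqrfun F)) v - dx k (sqrfun F) v).

(* G^j_i *)
Definition connection F j i : TR2 -> R := dy i (spray_coef F j).

(* delta_i *)
Definition hderive F i f v : R :=
  dx i f v - \sum_j connection F j i v * dy j f v.

(* S(f) *)
Definition spray F f v : R :=
  \sum_i ycomp i v * dx i f v - 2 * \sum_i spray_coef F i v * dy i f v.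

(* Pair (a, b) such that w_i = a l_i + b m_i; it is unique where (l, m) is a
   coframe. *)
Definition frame_comp F m (w : 'I_2 -> R) v : R * R :=
  [get ab : R * R | forall i, w i = ab.1 * ell F i v + ab.2 * m i v].

(* f_{;1}, f_{;2}, f_{,1}, f_{,2} *)
Definition v1 F m f v : R := (frame_comp F m (fun i => F v * dy i f v) v).1.
Definition v2 F m f v : R := (frame_comp F m (fun i => F v * dy i f v) v).2.
Definition h1 F m f v : R := (frame_comp F m (fun i => hderive F i f v) v).1.
Definition h2 F m f v : R := (frame_comp F m (fun i => hderive F i f v) v).2.

Definition main_scalar F m v : R :=
  [get I : R | forall i j k, F v * cartan F i j k v = I * m i v * m j v * m k v].

Definition ac_sigma eps F m phi v : R :=
  v2 F m (v2 F m phi) v + eps * main_scalar F m v * v2 F m phi v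
  + 2 * v2 F m phi v ^+ 2.
Definition ac_rho eps F m phi v : R :=
  (ac_sigma eps F m phi v + eps - v2 F m phi v ^+ 2)^-1.

Definition aniso_conf F phi v : R := expR (phi v) * F v.
Definition aniso_conf_frame eps F m phi i v : R :=
  expR (phi v) * Num.sqrt (eps / ac_rho eps F m phi v) * m i v.

End LocalFormulas.

Section Geometry.
Context {R : realType} {M : surface R}.
Local Notation TR2 := ('rV[R]_2 * 'rV[R]_2)%type.
Implicit Types (c : chart R M) (A : tset R M) (F phi : tfun R M) (eps : R).
Implicit Types m : chart R M -> 'I_2 -> TR2 -> R.

Record conic_pseudo_finsler A F : Prop := ConicPseudoFinsler {
  cpf_smooth : smooth_function_on A F;
  cpf_homogeneous : homogeneous_on A 1 F;
  cpf_nondegenerate :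
    forall c v, atlas c -> A c v -> metric (F c) v \in unitmx }.

(* The field m_i is determined by F up to sign only, and need not exist globally
   (e.g. when M is not orientable); a frame is therefore chosen in each chart
   separately, without any compatibility between charts. *)
Definition modified_berwald_frame A eps F m :=
  forall c, atlas c ->
    (forall i, smooth_on (A c) (m c i)) /\
    (forall v i j, A c v -> metric (F c) v i j =
       ell (F c) i v * ell (F c) j v + eps * m c i v * m c j v).

(* Negation of "I = 0" in the sense that F is Riemannian on no nonempty open
   part of A. *)
Definition non_riemannian A F m :=
  forall c (V : set TR2), atlas c -> open V -> V `<=` A c -> V !=set0 ->
    exists2 v, V v & main_scalar (F c) (m c) v != 0.

Definition aniso_conformal_factor A eps F m phi :=
  [/\ smooth_function_on A phi, homogeneous_on A 0 phi &
      forall c v, atlas c -> A c v ->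
        eps + ac_sigma eps (F c) (m c) (phi c) v
          - v2 (F c) (m c) (phi c) v ^+ 2 != 0].

Definition proper_change A F m phi :=
  forall c v, atlas c -> A c v -> v2 (F c) (m c) (phi c) v != 0.

(* Condition under which sqrt (eps / rho) is a genuine square root, i.e. under
   which the frame of e^phi F carries the same sign eps as that of F. *)
Definition same_frame_sign A eps F m phi :=
  forall c v, atlas c -> A c v ->
    0 < eps / ac_rho eps (F c) (m c) (phi c) v.

Definition change_metric F phi : tfun R M :=
  fun c => aniso_conf (F c) (phi c).
Definition change_frame eps F m phi : chart R M -> 'I_2 -> TR2 -> R :=
  fun c => aniso_conf_frame eps (F c) (m c) (phi c).

(* The properties below depend on the chart c in which they are expressed. *)

(* F0^i_{jk} (partial_i phi) = 0, with F0^i_{jk} the raised Cartan tensor of F0: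
   C-anisotropic for F0 = F, and \bar C-anisotropic for F0 = e^phi F. *)
Definition cartan_anisotropic A (F0 : tfun R M) phi c :=
  forall v j k, A c v ->
    \sum_i cartan_up (F0 c) i j k v * dx i (phi c) v = 0.

Definition minkowski_coordinates A F c :=
  forall v i, A c v -> spray_coef (F c) i v = 0.

Definition projectively_equivalent A F F' c :=
  exists P : TR2 -> R, forall v i, A c v ->
    spray_coef (F' c) i v = spray_coef (F c) i v + P v * ycomp i v.

(* Hamel's equation *)
Definition projectively_flat A F c :=
  forall v, A c v ->
    dy (0 : 'I_2) (dx (1 : 'I_2) (F c)) v =
    dy (1 : 'I_2) (dx (0 : 'I_2) (F c)) v.

Definition first_integral A F phi c :=
  forall v, A c v -> spray (F c) (phi c) v = 0.

(* G^k l_k / F^2 *)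
Definition spray_ell F c v : R :=
  (\sum_k spray_coef (F c) k v * ell (F c) k v) / F c v ^+ 2.

End Geometry.

(* Main.v *)
Require Import Defs.
From mathcomp Require Import all_boot all_order all_algebra.
From mathcomp Require Import all_classical all_reals all_analysis.
From mathcomp Require Import ring.
Set Implicit Arguments.
Unset Strict Implicit.
Unset Printing Implicit Defensive.
Import Order.TTheory GRing.Theory Num.Theory.
Import numFieldNormedType.Exports.
Local Open Scope classical_set_scope.
Local Open Scope ring_scope.

(** All the properties in the theorem are local, and in one chart they reduce to
    proportionality of covectors of the plane.

    The vector [y] is annihilated by a single line of covectors, spanned by
    [n = (y^1, - y^0)], which is also the line of [m]. The Cartan tensor is
    symmetric and annihilated by [y], hence equal to [K n_i n_j n_k]. Raising an
    index of [n] gives a vector orthogonal to [l], because [g_{ij} y^j = F l_i].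
    So, wherever [K] is not 0, [C^i_{jk} w_i = 0] means that [w] is proportional
    to [l]; the exceptional points are reached by continuity, a non-Riemannian
    metric having [K] nonzero on a dense set ([cartan_aniso_iff]). For
    [e^phi F] the covector [l] becomes [e^phi (l + phi_{;2} m)]. Thus
    C-anisotropy says that [partial phi] is proportional to [l], and
    C-bar-anisotropy that it is proportional to [l + phi_{;2} m]
    ([det_ell_frame], [det_ell_conf]).

    Let [H] be the defect in Hamel's equation. With lowered index the spray is
    [(y^r partial_r F l_k + F H n_k) / 2] ([spray_lower]), so [H = 0] holds
    exactly where [G] is proportional to [y], that is where [G^k m_k = 0].

    (ii) If [H = 0] on the chart, then [G^i = P y^i], and [delta_i phi] is
    [partial_i phi - phi_{;2} (P / F) m_i] with [P / F = G^k l_k / F^2]; both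
    criteria are then read off the components of [partial phi]
    ([horizontal_flat]).

    (iii) If [partial phi] is proportional to both [l] and [l + phi_{;2} m], it is
    0, because [phi_{;2}] is not. What remains of [S(phi)] is
    [- 2 phi_{;2} G^k m_k / F] ([both_anisotropic], [spray_first_integral]).

    (i) If [G = 0], neither [F] nor [m] depends on [x] ([minkowski_dx],
    [minkowski_dx_frame]), and projective equivalence is Hamel's equation for
    [e^phi F]. By C-bar-anisotropy this is the equality of
    [partial_1] of the derivative of [phi] along [y^0] and [partial_0] of its
    derivative along [y^1] ([hamel_conf]). As [F] times the vertical derivative
    of [phi] is [phi_{;2} m], the equality says that [partial (phi_{;2})] is
    proportional to [m], that is [phi_{;2,1} = 0] ([minkowski_h1]).

    Symmetry of second derivatives ([derive_sym]) and Euler's relations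
    ([euler_homogeneous], [euler_dx], [euler_dy]) are used throughout. *)

(** * Directional derivatives and the symmetry of second derivatives *)

Section Calculus.
Context {R : realType} {V : normedModType R}.
Implicit Types (f g : V -> R) (U : set V) (v w x : V).

(** A directional derivative at a point of an open set depends only on the
    values taken on that set. *)
Lemma derive_eq_open U f g v x : open U -> U x ->
  (forall y, U y -> f y = g y) -> 'D_v f x = 'D_v g x.
Proof.
move=> oU Ux fg; apply: near_eq_derive.
by move: (open_nbhs_nbhs (conj oU Ux)); apply: filterS => y /fg.
Qed.

Lemma deriveM_fun f g v x : differentiable f x -> differentiable g x ->
  'D_v (fun y => f y * g y) x = f x * 'D_v g x + g x * 'D_v f x.
Proof. by move=> df dg; rewrite (deriveM (diff_derivable df) (diff_derivable dg)). Qed.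

Lemma deriveD_fun f g v x : differentiable f x -> differentiable g x ->
  'D_v (fun y => f y + g y) x = 'D_v f x + 'D_v g x.
Proof. by move=> df dg; rewrite (deriveD (diff_derivable df) (diff_derivable dg)). Qed.

Lemma differentiableM_fun f g x : differentiable f x -> differentiable g x ->
  differentiable (fun y => f y * g y) x.
Proof. exact: differentiableM. Qed.

Lemma differentiableD_fun f g x : differentiable f x -> differentiable g x ->
  differentiable (fun y => f y + g y) x.
Proof. exact: differentiableD. Qed.

Lemma differentiableB_fun f g x : differentiable f x -> differentiable g x ->
  differentiable (fun y => f y - g y) x.
Proof. exact: differentiableB. Qed.

Lemma smooth_on_differentiable U f x : smooth_on U f -> U x ->
  differentiable f x.
Proof. by move=> sf Ux; exact: (sf [::]). Qed.

Lemma smooth_on_derive U f v : smooth_on U f -> smooth_on U ('D_v f).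
Proof.
move=> sf vs x Ux; have -> : iter_derive vs ('D_v f) = iter_derive (rcons vs v) f.
  by elim: vs => //= u vs ->.
exact: sf.
Qed.

(** A directional derivative is the derivative along a line. *)
Lemma is_derive_line f v x (s : R) : differentiable f (s *: v + x) ->
  is_derive s 1 (fun t : R => f (t *: v + x)) ('D_v f (s *: v + x)).
Proof.
move=> df.
have E : (fun h : R => h^-1 *: (f (h *: v + (s *: v + x)) - f (s *: v + x))) =
   (fun h : R => h^-1 *: (f ((h *: (1 : R) + s) *: v + x) - f (s *: v + x))).
  by apply/funext => h; rewrite [h *: 1]mulr1 scalerDl addrA.
apply: DeriveDef; last by rewrite /derive /= -E.
by have := diff_derivable (v := v) df; rewrite /derivable /= E.
Qed.

(** A small parallelogram along [v] and [w] stays in a neighbourhood of [x]. *)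
Lemma near_affine2 (N : set V) x v w : nbhs x N ->
  exists2 d : R, 0 < d &
    forall s t : R, `|s| < d -> `|t| < d -> N (s *: v + (t *: w + x)).
Proof.
move=> Nx.
pose a (p : R * R) := p.1 *: v + (p.2 *: w + x).
have ca : {for (0, 0), continuous a}.
  apply: cvgD; first by apply: cvgZr_tmp; exact: cvg_fst.
  apply: cvgD; last exact: cvg_cst.
  by apply: cvgZr_tmp; exact: cvg_snd.
have : nbhs ((0, 0) : R * R) (a @^-1` N) by apply: ca; rewrite /a/= !scale0r !add0r.
move=> /nbhs_ballP[d /= d0 dN]; exists d => // s t sd td.
by apply: (dN (s, t)); split; rewrite /ball/= sub0r normrN.
Qed.

Lemma derive_translate f v z x :
  'D_v (fun y => f (z + y)) x = 'D_v f (z + x).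
Proof.
have E : (fun k : R => k^-1 *: (f (z + (k *: v + x)) - f (z + x))) =
         (fun k : R => k^-1 *: (f (k *: v + (z + x)) - f (z + x))).
  by apply/funext => k; rewrite (addrCA z).
by rewrite /derive /= E.
Qed.

Lemma mvt_line f v x (h : R) : 0 < h ->
  (forall s : R, 0 <= s <= h -> differentiable f (s *: v + x)) ->
  exists2 s : R, 0 < s < h & f (h *: v + x) - f x = 'D_v f (s *: v + x) * h.
Proof.
move=> h0 df.
pose g t := f (t *: v + x); pose dg s := 'D_v f (s *: v + x).
have dl (s : R) : s \in `[0, h] -> is_derive s 1 g (dg s).
  by rewrite in_itv => /df; exact: is_derive_line.
have gc : {within `[0, h], continuous g}.
  by apply: derivable_within_continuous => s /dl[].
have gd (s : R) : s \in `]0, h[ -> is_derive s 1 g (dg s).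
  by move=> sh; apply: dl; apply: subset_itv_oo_cc sh.
have [s] := @MVT R g dg 0 h h0 gd gc.
by rewrite in_itv /= subr0 /g /dg scale0r add0r; exists s.
Qed.

(** The second difference of [f] along [v] and [w], by the mean value theorem
    in the direction [v], then in the direction [w]. *)
Lemma second_difference f v w x (h : R) : 0 < h ->
  (forall s t : R, 0 <= s <= h -> 0 <= t <= h ->
     differentiable f (s *: v + (t *: w + x)) /\
     differentiable ('D_v f) (s *: v + (t *: w + x))) ->
  exists s t : R, [/\ 0 < s < h, 0 < t < h &
    f (h *: v + (h *: w + x)) - f (h *: v + x) - (f (h *: w + x) - f x) =
    'D_w ('D_v f) (s *: v + (t *: w + x)) * h * h].
Proof.
move=> h0 df.
have hh : 0 <= h <= h by rewrite ltW // lexx.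
have z0 : 0 <= (0 : R) <= h by rewrite lexx ltW.
have dfh (s : R) : 0 <= s <= h -> differentiable f (s *: v + (h *: w + x)).
  by move=> sh; case: (df s h sh hh).
have df0 (s : R) : 0 <= s <= h -> differentiable f (s *: v + x).
  by move=> sh; have [] := df s 0 sh z0; rewrite scale0r add0r.
pose g y := f (h *: w + y) - f y.
have dg (s : R) : 0 <= s <= h -> differentiable (fun y => f (h *: w + y)) (s *: v + x).
  move=> sh; apply: differentiable_comp; first by apply: differentiableD.
  by rewrite addrCA; exact: dfh.
have [s|s sh e1] := @mvt_line g v x h h0.
  by move=> sh; apply: differentiableB; [exact: dg|exact: df0].
have Dg : 'D_v g (s *: v + x) = 'D_v f (h *: w + (s *: v + x)) - 'D_v f (s *: v + x).
  have sh' : 0 <= s <= h by case/andP: sh => ? ?; rewrite !ltW.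
  rewrite /g deriveB; [|exact/diff_derivable/dg|exact/diff_derivable/df0].
  by rewrite derive_translate.
have [t|t th e2] := @mvt_line ('D_v f) w (s *: v + x) h h0.
  move=> th; rewrite addrCA.
  by have [] := df s t _ th => //; case/andP: sh => ? ?; rewrite !ltW.
exists s, t; split => //.
rewrite (addrCA (s *: v)) -e2 -Dg -e1 /g (addrCA (h *: w)).
by ring.
Qed.

Lemma nbhs_close2 U (a b : V -> R) x (e : R) : open U -> U x ->
  {for x, continuous a} -> {for x, continuous b} -> 0 < e ->
  nbhs x [set y | [/\ U y, `|a x - a y| < e & `|b x - b y| < e]].
Proof.
move=> oU Ux ca cb e0.
have nU : nbhs x U by exact: open_nbhs_nbhs.
have na : \forall y \near x, `|a x - a y| < e by move: (e) e0; apply/cvgrPdist_lt.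
have nb : \forall y \near x, `|b x - b y| < e by move: (e) e0; apply/cvgrPdist_lt.
by near=> y; split; near: y.
Unshelve. all: by end_near. Qed.

Lemma common_value_close (a b c d D h e : R) : 0 < h ->
  D = c * h * h -> D = d * h * h -> `|a - d| < e -> `|b - c| < e ->
  `|a - b| < e + e.
Proof.
move=> h0 Dc Dd ad bc.
have E : c = d.
  by apply: (mulIf (lt0r_neq0 h0)); apply: (mulIf (lt0r_neq0 h0)); rewrite -Dc -Dd.
have -> : a - b = (a - d) - (b - c) by rewrite E; ring.
exact: le_lt_trans (ler_normB _ _) (ltrD ad bc).
Qed.

(** Symmetry of second derivatives: both mixed derivatives are limits of the
    same second difference divided by [h ^+ 2]. *)
Lemma derive_sym U f v w x : open U -> smooth_on U f -> U x ->
  'D_v ('D_w f) x = 'D_w ('D_v f) x.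
Proof.
move=> oU sf Ux.
have df y : U y -> differentiable f y by exact: smooth_on_differentiable.
have dv y u : U y -> differentiable ('D_u f) y.
  by apply: smooth_on_differentiable; exact: smooth_on_derive.
have cvw u u' : {for x, continuous ('D_u ('D_u' f))}.
  apply: differentiable_continuous; apply: smooth_on_differentiable Ux.
  by do 2 apply: smooth_on_derive.
apply/eqP/negPn/negP => ne.
(* Near [x] each mixed derivative stays within half of the supposed gap. *)
pose e := `|'D_v ('D_w f) x - 'D_w ('D_v f) x| / 2.
have e0 : 0 < e.
  by apply: divr_gt0; [rewrite normr_gt0 subr_eq0|exact: ltr0n].
pose N := [set y | [/\ U y, `|'D_v ('D_w f) x - 'D_v ('D_w f) y| < e &
   `|'D_w ('D_v f) x - 'D_w ('D_v f) y| < e]].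
have Nx : nbhs x N.
  by apply: (@nbhs_close2 U ('D_v ('D_w f)) ('D_w ('D_v f))).
have [d d0 dN] := @near_affine2 N x v w Nx.
pose h := d / 2.
have h0 : 0 < h by rewrite divr_gt0.
have hd (s : R) : 0 <= s <= h -> `|s| < d.
  case/andP=> s0 sh; rewrite ger0_norm // (le_lt_trans sh) // /h.
  by rewrite ltr_pdivrMr // mulr_natr mulr2n ltrDl.
have NU (s t : R) : 0 <= s <= h -> 0 <= t <= h -> N (s *: v + (t *: w + x)).
  by move=> sh th; apply: dN; exact: hd.
(* The same second difference is computed in both orders of [v] and [w]. *)
have [s t sh th|s [t [sh th e1]]] := @second_difference f v w x h h0.
  by have [] := NU s t sh th; split; [exact: df|exact: dv].
have [s' t' sh' th'|t' [s' [th' sh' e2]]] := @second_difference f w v x h h0.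
  rewrite addrCA; have [] := NU t' s' th' sh'.
  by split; [exact: df|exact: dv].
have W (r : R) : 0 < r < h -> 0 <= r <= h by case/andP=> ? ?; rewrite !ltW.
have [_ _ n1] := NU s t (W _ sh) (W _ th).
have [_ n2 _] := NU s' t' (W _ sh') (W _ th').
rewrite (addrCA (h *: w)) in e2; rewrite (addrCA (t' *: w)) in e2.
have swap (p q r z : R) : p - q - (r - z) = p - r - (q - z) by ring.
rewrite swap in e2.
have := common_value_close h0 e1 e2 n2 n1.
by rewrite /e -splitr ltxx.
Qed.

End Calculus.

(** * Euler relations *)

Section PlaneSums.
Context {R : realType}.

Lemma sum2 (E : 'I_2 -> R) : \sum_i E i = E 0 + E 1.
Proof.
rewrite !big_ord_recl big_ord0 addr0; congr (_ + E _).
exact/val_inj.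
Qed.

Lemma ord2P (P : 'I_2 -> Prop) : P 0 -> P 1 -> forall i, P i.
Proof.
move=> P0 P1 [[|[|//]] hi]; first by rewrite (_ : Ordinal hi = 0) //; exact/val_inj.
by rewrite (_ : Ordinal hi = 1) //; exact/val_inj.
Qed.

End PlaneSums.

Section Euler.
Context {R : realType}.
Local Notation TR2 := ('rV[R]_2 * 'rV[R]_2)%type.
Implicit Types (U : set TR2) (f : TR2 -> R) (v : TR2) (i j k : 'I_2).

Lemma smooth_on_dx U f i : smooth_on U f -> smooth_on U (dx i f).
Proof. exact: smooth_on_derive. Qed.

Lemma smooth_on_dy U f i : smooth_on U f -> smooth_on U (dy i f).
Proof. exact: smooth_on_derive. Qed.

Lemma dx_dy_sym U f i j v : open U -> smooth_on U f -> U v ->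
  dx i (dy j f) v = dy j (dx i f) v.
Proof. by move=> oU sf Uv; exact: derive_sym oU sf Uv. Qed.

Lemma dy_dy_sym U f i j v : open U -> smooth_on U f -> U v ->
  dy i (dy j f) v = dy j (dy i f) v.
Proof. by move=> oU sf Uv; exact: derive_sym oU sf Uv. Qed.

Lemma differentiable_ycomp i v : differentiable (@ycomp R i) v.
Proof.
apply: (@differentiable_comp _ _ _ _ snd (fun y : 'rV[R]_2 => y 0 i)).
  by apply: linear_differentiable => x; exact: cvg_snd.
exact: differentiable_coord.
Qed.

(** The derivative of the coordinate [y^i] along [w] is the [y^i]-component
    of [w]. *)
Lemma derive_ycomp i w v : 'D_w (@ycomp R i) v = w.2 0 i.
Proof.
have d : differentiable (@ycomp R i) (0 *: w + v) by exact: differentiable_ycomp.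
have /@derive_val := is_derive_line d.
rewrite scale0r add0r => <-.
have -> : (fun t : R => ycomp i (t *: w + v)) =
          (fun t : R => t * w.2 0 i + v.2 0 i).
  by apply/funext => t; rewrite /ycomp /= !mxE.
by rewrite deriveD_fun // deriveM_fun // derive_id !derive_cst mulr0 add0r addr0 mulr1.
Qed.

Lemma dy_ycomp i j v : dy j (@ycomp R i) v = (i == j)%:R.
Proof. by rewrite /dy derive_ycomp /= mxE eqxx. Qed.

Lemma derive_vertical f v (y : 'rV[R]_2) : differentiable f v ->
  'D_((0, y) : TR2) f v = y 0 0 * dy 0 f v + y 0 1 * dy 1 f v.
Proof.
move=> df; rewrite /dy !deriveE //.
have -> : ((0, y) : TR2) =
   y 0 0 *: ((0, delta_mx 0 0) : TR2) + y 0 1 *: ((0, delta_mx 0 1) : TR2).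
  congr (_, _); first by rewrite /= !scaler0 addr0.
  by apply/rowP; apply: ord2P; rewrite !mxE /= ?mulr1 ?mulr0 ?addr0 ?add0r.
by rewrite linearD !linearZ.
Qed.

Lemma vertical_line v (t : R) :
  t *: ((0, v.2) : TR2) + v = (v.1, (1 + t) *: v.2).
Proof.
case: v => x y; congr (_, _); rewrite /=; first by rewrite scaler0 add0r.
by rewrite scalerDl scale1r addrC.
Qed.

(** [y^i] contracted with the vertical derivative of [f] is [r f] on [U]: the
    infinitesimal form of positive homogeneity of degree [r] in [y]. *)
Definition euler U (r : R) f :=
  forall v, U v -> ycomp 0 v * dy 0 f v + ycomp 1 v * dy 1 f v = r * f v.

Lemma euler_homogeneous U (r : nat) f : open U -> smooth_on U f ->
  (forall v (lambda : R), U v -> 0 < lambda ->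
     f (v.1, lambda *: v.2) = lambda ^+ r * f v) ->
  euler U r%:R f.
Proof.
move=> oU sf hf v Uv.
have df : differentiable f v by exact: smooth_on_differentiable sf Uv.
rewrite -[LHS]/(v.2 0 0 * dy 0 f v + v.2 0 1 * dy 1 f v) -derive_vertical //.
have d0 : differentiable f (0 *: ((0, v.2) : TR2) + v) by rewrite scale0r add0r.
have /@derive_val := is_derive_line d0.
rewrite scale0r add0r => <-.
have E : \forall t \near (0 : R),
    (1 + t) ^+ r * f v = f (t *: ((0, v.2) : TR2) + v).
  near=> t.
  have t0 : 0 < 1 + t.
    near: t; exists 1 => //= s /=; rewrite sub0r normrN => s1.
    by move: s1; rewrite ltr_norml -subr_gt0 => /andP[+ _]; rewrite opprK addrC.
  by rewrite vertical_line hf.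
rewrite -(near_eq_derive _ E).
have d1 (t : R) : differentiable (fun t : R => 1 + t) t by exact: differentiableD_fun.
have pE : (fun t : R => (1 + t) ^+ r) = (fun t : R => 1 + t) ^+ r.
  by apply/funext => t; rewrite exprfctE.
have dX : differentiable (fun t : R => (1 + t) ^+ r) (0 : R).
  rewrite pE; case: (r) => [|n]; first exact: differentiable_cst.
  exact: (differentiableX n (d1 0)).
rewrite deriveM_fun // derive_cst mulr0 add0r.
have -> : 'D_1 (fun t : R => (1 + t) ^+ r) (0 : R) = r%:R.
  rewrite pE (deriveX r (diff_derivable (d1 0))) deriveD_fun // derive_cst derive_id.
  by rewrite addr0 add0r expr1n mulr1 [LHS]mulr1.
by rewrite mulrC.
Unshelve. all: by end_near. Qed.

(** Differentiating the Euler relation along [w] adds the derivative of [f]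
    along the [y]-part of [w]. *)
Lemma euler_derive U (r : R) f w v : open U -> smooth_on U f -> euler U r f ->
  U v ->
  ycomp 0 v * dy 0 ('D_w f) v + ycomp 1 v * dy 1 ('D_w f) v =
  r * 'D_w f v - (w.2 0 0 * dy 0 f v + w.2 0 1 * dy 1 f v).
Proof.
move=> oU sf ef Uv.
have df (g : TR2 -> R) : smooth_on U g -> differentiable g v.
  by move=> sg; exact: smooth_on_differentiable sg Uv.
have dyc := differentiable_ycomp.
have sd i : differentiable (dy i f) v by apply: df; exact: smooth_on_dy.
have prod i : 'D_w (fun u => ycomp i u * dy i f u) v =
    ycomp i v * dy i ('D_w f) v + dy i f v * w.2 0 i.
  apply: (etrans (deriveM_fun w (dyc i v) (sd i))).
  exact: (congr2 (fun a b => ycomp i v * a + dy i f v * b)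
    (derive_sym _ _ oU sf Uv) (derive_ycomp i w v)).
have dprod i : differentiable (fun u => ycomp i u * dy i f u) v.
  by apply: differentiableM_fun; [exact: dyc|exact: sd].
have lhs := etrans (deriveD_fun w (dprod 0) (dprod 1)) (congr2 +%R (prod 0) (prod 1)).
have rhs := deriveM_fun w (differentiable_cst r v) (df f sf).
rewrite derive_cst mulr0 addr0 in rhs.
have e := etrans (esym lhs) (etrans (derive_eq_open w oU Uv ef) rhs).
have alg (a b c d p q z t r' : R) :
    a * b + c * d + (p * q + z * t) = r' -> a * b + p * q = r' - (d * c + t * z).
  by move=> <-; ring.
exact: (alg _ _ _ _ _ _ _ _ _ e).
Qed.

Lemma euler_dx U (r : R) f k : open U -> smooth_on U f -> euler U r f ->
  euler U r (dx k f).
Proof.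
move=> oU sf ef v Uv; apply: etrans (euler_derive _ oU sf ef Uv) _.
have alg (a b c d e : R) : a = 0 -> b = 0 -> e - (a * c + b * d) = e.
  by move=> -> ->; ring.
exact (alg _ _ _ _ _ (mxE _ _ _ _) (mxE _ _ _ _)).
Qed.

Lemma euler_dy U (r : R) f k : open U -> smooth_on U f -> euler U r f ->
  euler U (r - 1) (dy k f).
Proof.
move=> oU sf ef v Uv; rewrite (euler_derive _ oU sf ef Uv) /= !mxE.
rewrite mulrBl mul1r; congr (_ - _); move: k; apply: ord2P.
  by rewrite /= mul1r mul0r addr0.
by rewrite /= mul1r mul0r add0r.
Qed.

End Euler.

(** * Local formulas of a pseudo-Finsler metric *)

Section Formulas.
Context {R : realType}.
Local Notation TR2 := ('rV[R]_2 * 'rV[R]_2)%type.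
Implicit Types (U : set TR2) (f F : TR2 -> R) (v w : TR2) (i j k : 'I_2).

Lemma mx_solve (g : 'M[R]_2) (a b : 'I_2 -> R) : g \in unitmx ->
  (forall k, \sum_i g k i * a i = b k) ->
  forall i, a i = \sum_k invmx g i k * b k.
Proof.
move=> gu ab i.
have E : g *m (\col_k a k) = \col_k b k.
  by apply/colP => k; rewrite !mxE -ab; apply: eq_bigr => l _; rewrite !mxE.
have := congr1 (fun B : 'cV[R]_2 => (invmx g *m B) i 0) E.
rewrite mulmxA mulVmx // mul1mx !mxE => ->.
by apply: eq_bigr => l _; rewrite [in LHS]mxE.
Qed.

Lemma mx_solve_inv (g : 'M[R]_2) (b : 'I_2 -> R) k : g \in unitmx ->
  \sum_i g k i * (\sum_l invmx g i l * b l) = b k.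
Proof.
move=> gu.
have : (g *m (invmx g *m (\col_k b k))) k 0 = b k.
  by rewrite mulmxA mulmxV // mul1mx mxE.
rewrite mxE => <-; apply: eq_bigr => i _; rewrite [in RHS]mxE.
by congr (_ * _); apply: eq_bigr => l _; rewrite mxE.
Qed.

(** A conic pseudo-Finsler metric read in one chart: [U] is the image of the
    conic bundle, and homogeneity is used through the Euler relation only. *)
Record local_finsler U F : Prop := LocalFinsler {
  lf_open : open U;
  lf_nonzero : forall v, U v -> v.2 != 0;
  lf_smooth : smooth_on U F;
  lf_euler : euler U 1 F;
  lf_unit : forall v, U v -> metric F v \in unitmx }.

Lemma derive_sqr U F w v : open U -> smooth_on U F -> U v ->
  'D_w (sqrfun F) v = 2 * F v * 'D_w F v.
Proof.
move=> oU sF Uv; have d := smooth_on_differentiable sF Uv.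
have alg (a b : R) : a * b + a * b = 2 * a * b by ring.
exact: etrans (deriveM_fun w d d) (alg _ _).
Qed.

Lemma derive2_sqr U F w u v : open U -> smooth_on U F -> U v ->
  'D_w ('D_u (sqrfun F)) v =
  2 * ('D_w F v * 'D_u F v + F v * 'D_w ('D_u F) v).
Proof.
move=> oU sF Uv; have d := smooth_on_differentiable sF Uv.
have du := smooth_on_differentiable (smooth_on_derive u sF) Uv.
have d2 : differentiable (fun z => 2 * F z) v.
  by apply: differentiableM_fun; [exact: differentiable_cst|exact: d].
have e : 'D_w (fun z => 2 * F z) v = 2 * 'D_w F v.
  apply: etrans (deriveM_fun w (differentiable_cst (2 : R) v) d) _.
  by rewrite derive_cst mulr0 addr0.
apply: etrans (derive_eq_open w oU Uv (fun z Uz => derive_sqr u oU sF Uz)) _.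
apply: etrans (deriveM_fun w d2 du) _.
apply: etrans (congr1 (fun a => 2 * F v * 'D_w ('D_u F) v + 'D_u F v * a) e) _.
have alg (a b c z : R) : 2 * a * b + c * (2 * z) = 2 * (z * c + a * b) by ring.
exact: alg.
Qed.

Lemma metricE U F v i j : open U -> smooth_on U F -> U v ->
  metric F v i j = dy i F v * dy j F v + F v * dy i (dy j F) v.
Proof.
move=> oU sF Uv; rewrite mxE.
have := derive2_sqr ((0, delta_mx 0 i) : TR2) (0, delta_mx 0 j) oU sF Uv.
have alg (a b : R) : a = 2 * b -> 2^-1 * a = b by move=> ->; field.
exact: alg.
Qed.

Lemma cartanE U F v i j k : open U -> smooth_on U F -> U v ->
  cartan F i j k v = 2^-1 *
   (dy k (dy i F) v * dy j F v + dy i F v * dy k (dy j F) v +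
    (dy k F v * dy i (dy j F) v + F v * dy k (dy i (dy j F)) v)).
Proof.
move=> oU sF Uv; rewrite /cartan; congr (_ * _).
have d0 := smooth_on_differentiable sF Uv.
have d1 l : differentiable (dy l F) v.
  by apply: smooth_on_differentiable Uv; exact: smooth_on_dy.
have d2 : differentiable (dy i (dy j F)) v.
  by apply: smooth_on_differentiable Uv; do 2 apply: smooth_on_dy.
apply: etrans (derive_eq_open ((0, delta_mx 0 k) : TR2) oU Uv
  (fun z Uz => metricE i j oU sF Uz)) _.
have da := differentiableM_fun (d1 i) (d1 j).
have db := differentiableM_fun d0 d2.
apply: etrans (deriveD_fun _ da db) _.
have alg (a b c a' b' c' : R) : a * b + b' * a' + c' = a' * b' + a * b + c'.
  by ring.
apply: etrans (congr2 +%R (deriveM_fun _ (d1 i) (d1 j)) (deriveM_fun _ d0 d2)) _.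
have alg2 (a b c z p q r s : R) :
  a * b + c * z + (p * q + r * s) = z * c + a * b + (s * r + p * q) by ring.
exact: alg2.
Qed.

Section Metric.
Context (U : set TR2) (F : TR2 -> R) (FU : local_finsler U F).
Let oU := lf_open FU.
Let sF := lf_smooth FU.

Lemma ycomp_neq0 v : U v -> ycomp 0 v != 0 \/ ycomp 1 v != 0.
Proof.
move=> Uv; have /eqP nz := lf_nonzero FU Uv.
have [y0|] := eqVneq (ycomp 0 v) 0; last by left.
have [y1|] := eqVneq (ycomp 1 v) 0; last by right.
by case: nz; apply/rowP; apply: ord2P; rewrite mxE.
Qed.

Lemma metric_sym v i j : U v -> metric F v i j = metric F v j i.
Proof.
move=> Uv.
have alg (a b c p q : R) : p = q -> a * b + c * p = b * a + c * q.
  by move=> ->; ring.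
apply: etrans (metricE i j oU sF Uv) (etrans _ (esym (metricE j i oU sF Uv))).
exact: alg (dy_dy_sym i j oU sF Uv).
Qed.

Lemma ell_euler v : U v -> ycomp 0 v * dy 0 F v + ycomp 1 v * dy 1 F v = F v.
Proof. by move=> Uv; rewrite (lf_euler FU Uv) mul1r. Qed.

Lemma ell_dy_euler v k : U v ->
  ycomp 0 v * dy 0 (dy k F) v + ycomp 1 v * dy 1 (dy k F) v = 0.
Proof.
move=> Uv; rewrite (euler_dy _ oU sF (lf_euler FU) Uv).
by rewrite subrr mul0r.
Qed.

(** [g_{ik} y^i = F l_k]. *)
Lemma metric_y v k : U v ->
  ycomp 0 v * metric F v 0 k + ycomp 1 v * metric F v 1 k = F v * dy k F v.
Proof.
move=> Uv; rewrite (metricE 0 k oU sF Uv) (metricE 1 k oU sF Uv).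
have alg (a b c d e f g h : R) : a * b + c * d = g -> a * e + c * f = 0 ->
  a * (b * h + g * e) + c * (d * h + g * f) = g * h.
  move=> e1 e2; transitivity ((a * b + c * d) * h + g * (a * e + c * f)); first ring.
  by rewrite e1 e2; ring.
exact: alg (ell_euler Uv) (ell_dy_euler k Uv).
Qed.

(** Solving [g_{ki} a^i = b_k] for [a]. *)
Lemma metricK v (a b : 'I_2 -> R) : U v ->
  (forall k, \sum_i metric F v k i * a i = b k) ->
  forall i, a i = \sum_k metric_inv F v i k * b k.
Proof. by move=> Uv ab; exact: (mx_solve (lf_unit FU Uv) ab). Qed.

Lemma metric_invK v (b : 'I_2 -> R) k : U v ->
  \sum_i metric F v k i * (\sum_l metric_inv F v i l * b l) = b k.
Proof. by move=> Uv; exact: (mx_solve_inv b k (lf_unit FU Uv)). Qed.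

(** [F] cannot vanish: where it does, [y] is in the kernel of [g]. *)
Lemma finsler_neq0 v : U v -> F v != 0.
Proof.
move=> Uv; apply/eqP => F0.
have y0 i : ycomp i v = 0.
  rewrite (@metricK v (fun i => ycomp i v) (fun=> 0) Uv); last first.
    move=> k; rewrite sum2 !(metric_sym k _ Uv).
    rewrite mulrC (mulrC (metric F v 1 k)) (metric_y k Uv).
    by rewrite F0 mul0r.
  by rewrite sum2 !mulr0 addr0.
by case: (ycomp_neq0 Uv); rewrite y0 eqxx.
Qed.

End Metric.
End Formulas.

(** * The spray and Hamel's equation *)

Section Spray.
Context {R : realType}.
Local Notation TR2 := ('rV[R]_2 * 'rV[R]_2)%type.
Implicit Types (f : TR2 -> R) (v : TR2) (i j k : 'I_2).

(** The covector [(y^1, - y^0)], which spans the annihilator of [y]. *)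
Definition conormal k v : R := if k == 0 then ycomp 1 v else - ycomp 0 v.

(** The defect in Hamel's equation. *)
Definition hamel f v : R := dy 0 (dx 1 f) v - dy 1 (dx 0 f) v.

(** [y^r] contracted with the horizontal derivative of [f]. *)
Definition dx_y f v : R := ycomp 0 v * dx 0 f v + ycomp 1 v * dx 1 f v.

Lemma conormal0 v : conormal 0 v = ycomp 1 v.
Proof. by []. Qed.

Lemma conormal1 v : conormal 1 v = - ycomp 0 v.
Proof. by []. Qed.

Lemma derive_ysum (f : 'I_2 -> TR2 -> R) k v :
  (forall r, differentiable (f r) v) ->
  dy k (fun u => ycomp 0 u * f 0 u + ycomp 1 u * f 1 u) v =
  f k v + (ycomp 0 v * dy k (f 0) v + ycomp 1 v * dy k (f 1) v).
Proof.
move=> df; pose w : TR2 := (0, delta_mx 0 k).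
have dp r : differentiable (fun u => ycomp r u * f r u) v.
  by apply: differentiableM_fun; [exact: differentiable_ycomp|exact: df].
have p r : dy k (fun u => ycomp r u * f r u) v =
    ycomp r v * dy k (f r) v + f r v * (r == k)%:R.
  apply: etrans (deriveM_fun w (differentiable_ycomp r v) (df r)) _.
  exact (congr1 (fun a => ycomp r v * dy k (f r) v + f r v * a) (dy_ycomp r k v)).
apply: etrans (etrans (deriveD_fun w (dp 0) (dp 1)) (congr2 +%R (p 0) (p 1))) _.
have alg (a b c d e0 e1 z : R) : c * e0 + d * e1 = z ->
   a + c * e0 + (b + d * e1) = z + (a + b) by move=> <-; ring.
apply: alg; move: k {w p}; apply: ord2P.
  by rewrite eqxx mulr1 mulr0 addr0.
by rewrite eqxx mulr1 mulr0 add0r.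
Qed.

Context (U : set TR2) (F : TR2 -> R) (FU : local_finsler U F).
Let oU := lf_open FU.
Let sF := lf_smooth FU.

(** By the symmetry of second derivatives and the Euler relation for
    [partial_k F], which is homogeneous of degree 1. *)
Lemma spray_rhs v k : U v ->
  \sum_r ycomp r v * dx r (dy k (sqrfun F)) v - dx k (sqrfun F) v =
  2 * (dx_y F v * dy k F v + F v * hamel F v * conormal k v).
Proof.
move=> Uv; rewrite sum2.
have t r : dx r (dy k (sqrfun F)) v =
    2 * (dx r F v * dy k F v + F v * dy k (dx r F) v).
  apply: etrans (derive2_sqr _ _ oU sF Uv) _.
  exact: (congr1 (fun a => 2 * (dx r F v * dy k F v + F v * a))
    (dx_dy_sym r k oU sF Uv)).
have s : dx k (sqrfun F) v = 2 * F v * dx k F v := derive_sqr _ oU sF Uv.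
have e := euler_dx k oU sF (lf_euler FU) Uv.
have E : ycomp 0 v * dy k (dx 0 F) v + ycomp 1 v * dy k (dx 1 F) v - dx k F v =
    hamel F v * conormal k v.
  rewrite -[dx k F v]mul1r -e /hamel; move: k {t s e}; apply: ord2P.
    rewrite conormal0.
    have alg (a b c d z : R) : a * d + b * c - (a * d + b * z) = (c - z) * b by ring.
    exact: alg.
  rewrite conormal1.
  have alg (a b c d z : R) : a * z + b * d - (a * c + b * d) = (c - z) * - a by ring.
  exact: alg.
rewrite (t 0) (t 1) s /dx_y.
have alg (a b c d l f p q h z : R) : a * p + b * q - z = h ->
  a * (2 * (c * l + f * p)) + b * (2 * (d * l + f * q)) - 2 * f * z =
  2 * ((a * c + b * d) * l + f * h).
  by move=> <-; ring.
rewrite (alg _ _ _ _ _ _ _ _ _ _ E).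
by rewrite -[F v * _ * _]mulrA.
Qed.

(** The spray coefficients with lowered index. *)
Lemma spray_lower v k : U v ->
  \sum_i metric F v k i * spray_coef F i v =
  2^-1 * (dx_y F v * dy k F v + F v * hamel F v * conormal k v).
Proof.
move=> Uv.
pose b l := 2^-1 * (dx_y F v * dy l F v + F v * hamel F v * conormal l v).
rewrite -[RHS](metric_invK FU b k Uv); apply: eq_bigr => i _; congr (_ * _).
rewrite /spray_coef mulr_sumr; apply: eq_bigr => l _.
rewrite (spray_rhs l Uv) /b.
have alg (x z : R) : 4^-1 * (x * (2 * z)) = x * (2^-1 * z) by field.
exact: alg.
Qed.

Lemma metric_colinear v (p : R) k : U v ->
  \sum_i metric F v k i * (p * ycomp i v) = p * F v * dy k F v.
Proof.
move=> Uv; rewrite sum2 (metric_sym FU k 0 Uv) (metric_sym FU k 1 Uv).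
have alg (a b c d q : R) : a * b + c * d = q -> b * (p * a) + d * (p * c) = p * q.
  by move=> <-; ring.
rewrite -mulrA; exact: alg (metric_y FU k Uv).
Qed.

(** Under Hamel's equation the spray is proportional to [y]. *)
Lemma hamel0_spray v i : U v -> hamel F v = 0 ->
  spray_coef F i v = dx_y F v / (2 * F v) * ycomp i v.
Proof.
move=> Uv H0.
pose b k := 2^-1 * (dx_y F v * dy k F v).
rewrite (metricK FU (a := fun j => spray_coef F j v) (b := b) Uv); last first.
  by move=> k; rewrite (spray_lower k Uv) H0 mulr0 mul0r addr0.
rewrite -(metricK FU (a := fun j => dx_y F v / (2 * F v) * ycomp j v) Uv) //.
move=> k; rewrite (metric_colinear _ k Uv) /b.
have nz := finsler_neq0 FU Uv.
have alg (a f l : R) : f != 0 -> a / (2 * f) * f * l = 2^-1 * (a * l).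
  by move=> ?; field.
exact: alg.
Qed.

(** Conversely, a spray proportional to [y] forces Hamel's equation and
    determines the factor. *)
Lemma spray_hamel0 v (p : R) : U v ->
  (forall i, spray_coef F i v = p * ycomp i v) ->
  hamel F v = 0 /\ dx_y F v = 2 * (p * F v).
Proof.
move=> Uv Gp.
have e k : p * F v * dy k F v =
    2^-1 * (dx_y F v * dy k F v + F v * hamel F v * conormal k v).
  rewrite -(metric_colinear _ k Uv) -(spray_lower k Uv).
  by apply: eq_bigr => i _; rewrite Gp.
have nz := finsler_neq0 FU Uv.
have yl := ell_euler FU Uv.
have a1 : dx_y F v = 2 * (p * F v).
  have := e 0; have := e 1; rewrite conormal0 conormal1.
  have alg (f l0 l1 y0 y1 d h : R) : f != 0 -> y0 * l0 + y1 * l1 = f ->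
     p * f * l1 = 2^-1 * (d * l1 + f * h * - y0) ->
     p * f * l0 = 2^-1 * (d * l0 + f * h * y1) -> d = 2 * (p * f).
    move=> f0 yl' e1 e0; apply: (mulIf f0); rewrite -[in d * f]yl'.
    transitivity (2 * (y0 * (2^-1 * (d * l0 + f * h * y1)) +
                       y1 * (2^-1 * (d * l1 + f * h * - y0)))); first by field.
    by rewrite -e0 -e1 -[X in _ = _ * X]yl'; ring.
  exact: alg.
split=> //.
have n k : hamel F v * conormal k v = 0.
  apply: (mulfI nz); rewrite mulr0; have := e k; rewrite a1.
  have alg (f l h c : R) : p * f * l = 2^-1 * (2 * (p * f) * l + f * h * c) ->
    f * (h * c) = 0.
    move=> q; transitivity (2 * (2^-1 * (2 * (p * f) * l + f * h * c)) - 2 * (p * f * l)).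
      by field.
    by rewrite -q; ring.
  exact: alg.
case: (ycomp_neq0 FU Uv) => yn.
  by apply: (mulIf yn); rewrite mul0r; apply: oppr_inj; rewrite oppr0 -mulrN; exact: n 1.
by apply: (mulIf yn); rewrite mul0r; exact: n 0.
Qed.

(** A metric with vanishing spray does not depend on [x]. *)
Lemma minkowski_dx k v : (forall u i, U u -> spray_coef F i u = 0) ->
  U v -> dx k F v = 0.
Proof.
move=> G0 Uv.
have HY u : U u -> hamel F u = 0 /\ dx_y F u = 0.
  move=> Uu; have [|H ->] := @spray_hamel0 u 0 Uu.
    by move=> i; rewrite G0 // mul0r.
  by rewrite mul0r mulr0.
have dF r : differentiable (dx r F) v.
  by apply: smooth_on_differentiable Uv; exact: smooth_on_dx.
(* Differentiate [y^r partial_r F = 0] along [y^k]; Hamel's equation and the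
   Euler relation turn the result into [2 partial_k F = 0]. *)
have e1 := derive_ysum k dF.
have e2 := derive_eq_open ((0, delta_mx 0 k) : TR2) oU Uv (fun u Uu => (HY u Uu).2).
have e3 := etrans (esym e1) e2.
rewrite derive_cst in e3.
have e4 := euler_dx k oU sF (lf_euler FU) Uv.
have [H _] := HY v Uv.
have e5 : ycomp 0 v * dy k (dx 0 F) v + ycomp 1 v * dy k (dx 1 F) v = dx k F v.
  rewrite -[dx k F v]mul1r -e4; move/eqP: H; rewrite subr_eq0 => /eqP H.
  move: k {e1 e2 e3 e4}; apply: ord2P.
    exact (congr1 (fun a => ycomp 0 v * dy 0 (dx 0 F) v + ycomp 1 v * a) H).
  exact (congr1 (fun a => ycomp 0 v * a + ycomp 1 v * dy 1 (dx 1 F) v) (esym H)).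
rewrite e5 in e3.
have alg (a : R) : a + a = 0 -> a = 0.
  by move=> /eqP; rewrite -mulr2n mulrn_eq0 => /eqP.
exact: alg.
Qed.

End Spray.

(** * The Cartan tensor in dimension two *)

Section Cartan.
Context {R : realType}.
Local Notation TR2 := ('rV[R]_2 * 'rV[R]_2)%type.
Implicit Types (f : TR2 -> R) (v : TR2) (i j k : 'I_2).

(** In dimension two a symmetric 3-tensor annihilated by [y] is a multiple of
    the cube of the conormal. *)
Lemma sym3_annihilated (C : 'I_2 -> 'I_2 -> 'I_2 -> R) (n : 'I_2 -> R)
    (y0 y1 : R) :
  (forall i j k, C i j k = C j i k) -> (forall i j k, C i j k = C i k j) ->
  (forall j k, y0 * C 0 j k + y1 * C 1 j k = 0) ->
  n 0 = y1 -> n 1 = - y0 -> y0 != 0 \/ y1 != 0 ->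
  exists K : R, forall i j k, C i j k = K * n i * n j * n k.
Proof.
move=> C12 C23 Cy n0 n1 nz.
have e000 := Cy 0 0; have e001 := Cy 0 1; have e011 := Cy 1 1.
rewrite (C12 1 0 0) (C23 0 1 0) in e000.
rewrite (C12 1 0 1) in e001.
have reduce (K : R) : C 0 0 0 = K * y1 ^+ 3 -> C 0 0 1 = - K * y0 * y1 ^+ 2 ->
    C 0 1 1 = K * y0 ^+ 2 * y1 -> C 1 1 1 = - K * y0 ^+ 3 ->
    forall i j k, C i j k = K * n i * n j * n k.
  move=> c0 c1 c2 c3; apply: ord2P; apply: ord2P; apply: ord2P; rewrite ?n0 ?n1.
  - by rewrite c0; ring.
  - by rewrite c1; ring.
  - by rewrite C23 c1; ring.
  - by rewrite c2; ring.
  - by rewrite C12 C23 c1; ring.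
  - by rewrite C12 c2; ring.
  - by rewrite C23 C12 c2; ring.
  - by rewrite c3; ring.
have div (a b c d : R) : a != 0 -> a * b + c * d = 0 -> b = - (c / a) * d.
  move=> a0 e; apply: (mulfI a0); transitivity (a * b + c * d - c * d); first by ring.
  by rewrite e; field.
move: (C 0 0 0) (C 0 0 1) (C 0 1 1) (C 1 1 1) e000 e001 e011 reduce.
move=> a b c d ea eb ec reduce.
case: nz => nz.
  have cE := div _ _ _ _ nz ec; have bE := div _ _ _ _ nz eb.
  have aE := div _ _ _ _ nz ea.
  exists (- d / y0 ^+ 3); apply: reduce; rewrite ?aE ?bE ?cE; by field.
rewrite addrC in ea; rewrite addrC in eb; rewrite addrC in ec.
have bE := div _ _ _ _ nz ea; have cE := div _ _ _ _ nz eb.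
have dE := div _ _ _ _ nz ec.
exists (a / y1 ^+ 3); apply: reduce; rewrite ?dE ?cE ?bE; by field.
Qed.

Context (U : set TR2) (F : TR2 -> R) (FU : local_finsler U F).
Let oU := lf_open FU.
Let sF := lf_smooth FU.

Lemma cartan_sym12 v i j k : U v -> cartan F i j k v = cartan F j i k v.
Proof.
move=> Uv; exact (congr1 (fun a => 2^-1 * a) (derive_eq_open _ oU Uv
  (fun u Uu => metric_sym FU i j Uu))).
Qed.

Lemma dy3_sym v i j k : U v ->
  dy k (dy i (dy j F)) v = dy j (dy i (dy k F)) v.
Proof.
move=> Uv.
apply: etrans (dy_dy_sym k i oU (smooth_on_dy j sF) Uv) _.
apply: etrans (derive_eq_open _ oU Uv (fun u Uu => dy_dy_sym k j oU sF Uu)) _.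
exact (dy_dy_sym i j oU (smooth_on_dy k sF) Uv).
Qed.

Lemma cartan_sym23 v i j k : U v -> cartan F i j k v = cartan F i k j v.
Proof.
move=> Uv; rewrite (cartanE i j k oU sF Uv) (cartanE i k j oU sF Uv).
have alg (fi fj fk f a c c' d h h' z z' : R) :
   c = c' -> h = h' -> a = d -> z = z' ->
   2^-1 * (a * fj + fi * c + (fk * h + f * z)) =
   2^-1 * (h' * fk + fi * c' + (fj * d + f * z')).
  by move=> -> -> -> ->; ring.
exact (alg _ _ _ _ _ _ _ _ _ _ _ _ (dy_dy_sym k j oU sF Uv)
  (dy_dy_sym i j oU sF Uv) (dy_dy_sym k i oU sF Uv) (dy3_sym i j k Uv)).
Qed.

Lemma cartan_y v j k : U v ->
  ycomp 0 v * cartan F 0 j k v + ycomp 1 v * cartan F 1 j k v = 0.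
Proof.
move=> Uv; rewrite (cartanE 0 j k oU sF Uv) (cartanE 1 j k oU sF Uv).
have e1 := ell_dy_euler FU k Uv.
have e2 := ell_dy_euler FU j Uv.
have e3 := ell_euler FU Uv.
have e4 := euler_dy k oU (smooth_on_dy j sF) (euler_dy j oU sF (lf_euler FU)) Uv.
have s i : dy k (dy i F) v = dy i (dy k F) v := dy_dy_sym k i oU sF Uv.
have s3 i : dy k (dy i (dy j F)) v = dy i (dy k (dy j F)) v :=
  dy_dy_sym k i oU (smooth_on_dy j sF) Uv.
have alg (y0 y1 fj fk f l0 l1 p0 p1 p0' p1' c q0 q1 t0 t1 t0' t1' : R) :
  y0 * p0' + y1 * p1' = 0 -> y0 * q0 + y1 * q1 = 0 -> y0 * l0 + y1 * l1 = f ->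
  y0 * t0' + y1 * t1' = (1 - 1 - 1) * c -> p0 = p0' -> p1 = p1' -> t0 = t0' ->
  t1 = t1' ->
  y0 * (2^-1 * (p0 * fj + l0 * c + (fk * q0 + f * t0))) +
  y1 * (2^-1 * (p1 * fj + l1 * c + (fk * q1 + f * t1))) = 0.
  move=> a1 a2 a3 a4 -> -> -> ->.
  transitivity (2^-1 * ((y0 * p0' + y1 * p1') * fj + (y0 * l0 + y1 * l1) * c +
    fk * (y0 * q0 + y1 * q1) + f * (y0 * t0' + y1 * t1'))); first by ring.
  by rewrite a1 a2 a3 a4; ring.
exact: alg e1 e2 e3 e4 (s 0) (s 1) (s3 0) (s3 1).
Qed.

Lemma cartan_conormal v : U v -> exists K : R, forall i j k,
  cartan F i j k v = K * conormal i v * conormal j v * conormal k v.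
Proof.
move=> Uv; apply: (@sym3_annihilated (fun i j k => cartan F i j k v)
  (fun i => conormal i v) (ycomp 0 v) (ycomp 1 v)).
- by move=> i j k; exact: cartan_sym12.
- by move=> i j k; exact: cartan_sym23.
- by move=> j k; exact: cartan_y.
- exact: conormal0.
- exact: conormal1.
- exact: (ycomp_neq0 FU Uv).
Qed.

(** The determinant of the covectors [w] and [l]; it vanishes if and only if
    [w] is proportional to [l]. *)
Definition det_ell f (w : 'I_2 -> R) v : R := w 0 * dy 1 f v - w 1 * dy 0 f v.

(** The vector [u] dual to the conormal is nonzero and orthogonal to [l], hence
    a nonzero multiple of [(l_1, - l_0)]. *)
Lemma conormal_dual v : U v -> exists u : 'I_2 -> R,
  [/\ forall i, u i = \sum_r metric_inv F v i r * conormal r v,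
      dy 0 F v * u 0 + dy 1 F v * u 1 = 0 & u 0 != 0 \/ u 1 != 0].
Proof.
move=> Uv; pose u i : R := \sum_r metric_inv F v i r * conormal r v.
exists u.
have gu k : metric F v k 0 * u 0 + metric F v k 1 * u 1 = conormal k v.
  by rewrite -(metric_invK FU (fun r => conormal r v) k Uv) sum2.
have nz := finsler_neq0 FU Uv.
split=> //.
  apply: (mulfI nz); rewrite mulr0.
  have my0 := metric_y FU 0 Uv; have my1 := metric_y FU 1 Uv.
  have alg (y0 y1 f l0 l1 a b c d p q : R) : y0 * a + y1 * c = f * l0 ->
    y0 * b + y1 * d = f * l1 -> a * p + b * q = y1 -> c * p + d * q = - y0 ->
    f * (l0 * p + l1 * q) = 0.
    move=> e1 e2 e3 e4.
    transitivity (p * (f * l0) + q * (f * l1)); first by ring.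
    rewrite -e1 -e2.
    transitivity (y0 * (a * p + b * q) + y1 * (c * p + d * q)); first by ring.
    by rewrite e3 e4; ring.
  exact: alg my0 my1 (gu 0) (gu 1).
have [u0|] := eqVneq (u 0) 0; last by left.
have [u1|] := eqVneq (u 1) 0; last by right.
have n k : conormal k v = 0 by rewrite -gu u0 u1 !mulr0 addr0.
case: (ycomp_neq0 FU Uv) => /eqP[].
  by apply: oppr_inj; rewrite oppr0; exact: (n 1).
exact: (n 0).
Qed.

(** The contraction [C^i_{jk} w_i] is [K n_j n_k (u . w)], and [u . w] is the
    determinant of [w] and [l] up to a nonzero factor. *)
Lemma cartan_contraction v (w : 'I_2 -> R) : U v ->
  (exists i j k, cartan F i j k v != 0) \/ det_ell F w v = 0 ->
  (forall j k, \sum_i cartan_up F i j k v * w i = 0) <-> det_ell F w v = 0.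
Proof.
move=> Uv H.
have [K CK] := cartan_conormal Uv.
have [u [uE lu un]] := conormal_dual Uv.
have E j k : \sum_i cartan_up F i j k v * w i =
    K * conormal j v * conormal k v * (u 0 * w 0 + u 1 * w 1).
  rewrite sum2 /cartan_up !uE !sum2 !CK.
  by ring.
have yl := ell_euler FU Uv; have nz := finsler_neq0 FU Uv.
rewrite /det_ell in H *; split=> [c0|d0]; last first.
  move=> j k; rewrite E.
  suff -> : u 0 * w 0 + u 1 * w 1 = 0 by rewrite mulr0.
  apply: (mulfI nz); rewrite mulr0.
  have alg (y0 y1 l0 l1 a b p q f : R) : y0 * l0 + y1 * l1 = f ->
    l0 * a + l1 * b = 0 -> p * l1 - q * l0 = 0 -> f * (a * p + b * q) = 0.
    move=> <- e1 e2.
    transitivity ((y0 * p + y1 * q) * (l0 * a + l1 * b) +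
      (y1 * a - y0 * b) * (p * l1 - q * l0)); first by ring.
    by rewrite e1 e2; ring.
  exact (alg _ _ _ _ _ _ _ _ _ yl lu d0).
case: H => // -[i [j [k]]]; rewrite CK => Kn.
have cn0 : K * conormal j v * conormal k v != 0.
  apply: contraNneq Kn => z.
  have alg (a b c d : R) : a * c * d = 0 -> a * b * c * d = 0.
    move=> e; transitivity (b * (a * c * d)); first by ring.
    by rewrite e mulr0.
  by rewrite alg.
have uw : u 0 * w 0 + u 1 * w 1 = 0.
  by apply: (mulfI cn0); rewrite mulr0 -E.
have alg (l0 l1 a b p q : R) : a != 0 \/ b != 0 -> l0 * a + l1 * b = 0 ->
    a * p + b * q = 0 -> p * l1 - q * l0 = 0.
  move=> [] nz' e1 e2; apply: (mulfI nz'); rewrite mulr0.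
    transitivity (l1 * (a * p + b * q) - q * (l0 * a + l1 * b)); first by ring.
    by rewrite e1 e2; ring.
  transitivity (p * (l0 * a + l1 * b) - l0 * (a * p + b * q)); first by ring.
  by rewrite e1 e2; ring.
exact (alg _ _ _ _ _ _ un lu uw).
Qed.

(** Where the Cartan tensor is generically nonzero, [C^i_{jk} partial_i phi = 0]
    on [U] if and only if the covector [partial phi] is proportional to [l]
    on [U], by continuity. *)
Lemma cartan_aniso_iff phi : smooth_on U phi ->
  (forall V : set TR2, open V -> V `<=` U -> V !=set0 ->
     exists2 v, V v & exists i j k, cartan F i j k v != 0) ->
  (forall v j k, U v -> \sum_i cartan_up F i j k v * dx i phi v = 0) <->
  (forall v, U v -> det_ell F (fun i => dx i phi v) v = 0).
Proof.
move=> sphi dense; split=> [c0 v Uv|d0 v j k Uv]; last first.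
  by move: j k; apply/(cartan_contraction Uv); [right|]; exact: d0.
apply/eqP/negPn/negP => dn.
pose d u := det_ell F (fun i => dx i phi u) u.
have cd : {for v, continuous d}.
  have dp i j : differentiable (fun u => dx i phi u * dy j F u) v.
    apply: differentiableM_fun.
      exact: (smooth_on_differentiable (smooth_on_dx i sphi) Uv).
    exact: (smooth_on_differentiable (smooth_on_dy j sF) Uv).
  exact: (differentiable_continuous (differentiableB_fun (dp 0 1) (dp 1 0))).
(* A nonzero determinant would persist on an open set, which contains points
   with a nonzero Cartan tensor. *)
have nd : nbhs v [set u | U u /\ d u != 0].
  have n1 : nbhs v U by exact: open_nbhs_nbhs.
  have n2 : nbhs v (d @^-1` [set z | z != 0]).
    by apply: cd; apply: open_nbhs_nbhs; split => //; exact: open_neq.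
  exact: (filterI n1 n2).
have [] := dense (interior [set u | U u /\ d u != 0]).
- exact: open_interior.
- by move=> u /interior_subset[].
- by exists v.
move=> u /interior_subset[Uu /eqP du] Cu; apply: du.
have [h _] := @cartan_contraction u (fun i => dx i phi u) Uu (or_introl Cu).
by apply: h => j k; exact: c0.
Qed.

End Cartan.

(** * The modified Berwald frame *)

Section Frame.
Context {R : realType}.
Local Notation TR2 := ('rV[R]_2 * 'rV[R]_2)%type.
Implicit Types (f : TR2 -> R) (v : TR2) (i j k : 'I_2) (w : 'I_2 -> R).

(** The determinant of the coframe [(l, m)]. *)
Definition frame_det F (m : 'I_2 -> TR2 -> R) v : R :=
  dy 0 F v * m 1 v - dy 1 F v * m 0 v.

(** The components in a nondegenerate coframe are those of any decomposition. *)
Lemma frame_compE F m w v (a b : R) : frame_det F m v != 0 ->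
  (forall i, w i = a * dy i F v + b * m i v) -> frame_comp F m w v = (a, b).
Proof.
move=> D0 wab; rewrite /frame_comp.
set P := (X in xget _ X).
have : P (xget point P) by apply: getPex; exists (a, b).
move: (xget point P) => [a' b'] /= h.
have h0 : a' * dy 0 F v + b' * m 0 v = a * dy 0 F v + b * m 0 v.
  by rewrite -wab -h.
have h1 : a' * dy 1 F v + b' * m 1 v = a * dy 1 F v + b * m 1 v.
  by rewrite -wab -h.
move: D0 h0 h1; rewrite /frame_det.
move: (dy 0 F v) (dy 1 F v) (m 0 v) (m 1 v) => l0 l1 m0 m1 D0 h0 h1.
congr (_, _); apply: (mulIf D0).
  transitivity ((a' * l0 + b' * m0) * m1 - (a' * l1 + b' * m1) * m0); first by ring.
  by rewrite h0 h1; ring.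
transitivity ((a' * l1 + b' * m1) * l0 - (a' * l0 + b' * m0) * l1); first by ring.
by rewrite h0 h1; ring.
Qed.

Lemma frame_decomposition F m w v i : frame_det F m v != 0 ->
  w i = (frame_comp F m w v).1 * dy i F v + (frame_comp F m w v).2 * m i v.
Proof.
move=> D0; pose a := (w 0 * m 1 v - w 1 * m 0 v) / frame_det F m v.
pose b := (dy 0 F v * w 1 - dy 1 F v * w 0) / frame_det F m v.
have E j : w j = a * dy j F v + b * m j v.
  move: D0; rewrite /a /b /frame_det.
  move: j; apply: ord2P;
  move: (dy 0 F v) (dy 1 F v) (m 0 v) (m 1 v) (w 0) (w 1) => l0 l1 m0 m1 w0 w1 D0;
  by field.
by rewrite (frame_compE D0 E).
Qed.

(** If the Cartan tensor vanished, 0 would be the only main scalar. *)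
Lemma main_scalar_neq0 F m v : m 0 v != 0 \/ m 1 v != 0 ->
  main_scalar F m v != 0 -> exists i j k, cartan F i j k v != 0.
Proof.
move=> mn; apply: contra_neqP => C0.
have {}C0 i j k : cartan F i j k v = 0.
  by apply/eqP/negPn/negP => Cn; apply: C0; exists i, j, k.
rewrite /main_scalar; set P := (X in xget _ X).
have : P (xget point P).
  by apply: getPex; exists 0 => i j k; rewrite C0 mulr0 !mul0r.
move: (xget point P) => I PI.
have cube i : m i v != 0 -> I = 0.
  move=> mi; have := PI i i i; rewrite C0 mulr0 => /esym/eqP.
  by rewrite !mulf_eq0 (negbTE mi) !orbF => /eqP.
by case: mn => /cube.
Qed.

Context (U : set TR2) (F : TR2 -> R) (FU : local_finsler U F).
Context (eps : R) (m : 'I_2 -> TR2 -> R).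
Hypothesis eps_neq0 : eps != 0.
Hypothesis frame_metric : forall v i j, U v ->
  metric F v i j = ell F i v * ell F j v + eps * m i v * m j v.
Let oU := lf_open FU.
Let sF := lf_smooth FU.

Lemma frame_y v : U v -> ycomp 0 v * m 0 v + ycomp 1 v * m 1 v = 0.
Proof.
move=> Uv.
have e k : ycomp 0 v * (dy 0 F v * dy k F v + eps * m 0 v * m k v) +
           ycomp 1 v * (dy 1 F v * dy k F v + eps * m 1 v * m k v) =
           F v * dy k F v.
  rewrite -(metric_y FU k Uv) (frame_metric 0 k Uv) (frame_metric 1 k Uv).
  by [].
have yl := ell_euler FU Uv.
have alg (y0 y1 l0 l1 m0 m1 f : R) :
  y0 * l0 + y1 * l1 = f ->
  y0 * (l0 * l0 + eps * m0 * m0) + y1 * (l1 * l0 + eps * m1 * m0) = f * l0 ->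
  y0 * (l0 * l1 + eps * m0 * m1) + y1 * (l1 * l1 + eps * m1 * m1) = f * l1 ->
  y0 * m0 + y1 * m1 = 0.
  move=> <- e0 e1; apply/eqP; rewrite -sqrf_eq0; apply/eqP.
  apply: (mulfI eps_neq0); rewrite mulr0.
  transitivity (y0 * (y0 * (l0 * l0 + eps * m0 * m0) + y1 * (l1 * l0 + eps * m1 * m0)) +
    y1 * (y0 * (l0 * l1 + eps * m0 * m1) + y1 * (l1 * l1 + eps * m1 * m1)) -
    (y0 * l0 + y1 * l1) ^+ 2); first by ring.
  by rewrite e0 e1; ring.
exact (alg _ _ _ _ _ _ _ yl (e 0) (e 1)).
Qed.

Lemma frame_neq0 v : U v -> m 0 v != 0 \/ m 1 v != 0.
Proof.
move=> Uv.
have [m0|] := eqVneq (m 0 v) 0; last by left.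
have [m1|] := eqVneq (m 1 v) 0; last by right.
pose a (i : 'I_2) : R := if i == 0 then dy 1 F v else - dy 0 F v.
have ga k : \sum_i metric F v k i * a i = 0.
  rewrite sum2 (frame_metric k 0 Uv) (frame_metric k 1 Uv) m0 m1.
  have alg (p q r c d : R) : (p * q + c * 0) * r + (p * r + d * 0) * - q = 0 by ring.
  exact: alg.
have a0 i : a i = 0.
  by rewrite (metricK FU (b := fun=> 0) Uv ga) sum2 !mulr0 addr0.
have := ell_euler FU Uv.
have -> : dy 1 F v = 0 by exact: (a0 0).
have -> : dy 0 F v = 0 by apply: oppr_inj; rewrite oppr0; exact: (a0 1).
by rewrite !mulr0 addr0 => /esym/eqP; rewrite (negbTE (finsler_neq0 FU Uv)).
Qed.

Lemma frame_det_neq0 v : U v -> frame_det F m v != 0.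
Proof.
move=> Uv; apply/eqP => D0.
have yl := ell_euler FU Uv; have ym := frame_y Uv; have nz := finsler_neq0 FU Uv.
move: D0 yl ym nz (frame_neq0 Uv); rewrite /frame_det.
move: (dy 0 F v) (dy 1 F v) (m 0 v) (m 1 v) (ycomp 0 v) (ycomp 1 v) (F v).
move=> l0 l1 m0 m1 y0 y1 f D0 yl ym nz.
have z0 : m0 = 0.
  apply: (mulfI nz); rewrite mulr0 -yl.
  transitivity (l0 * (y0 * m0 + y1 * m1) - y1 * (l0 * m1 - l1 * m0)); first by ring.
  by rewrite ym D0; ring.
have z1 : m1 = 0.
  apply: (mulfI nz); rewrite mulr0 -yl.
  transitivity (l1 * (y0 * m0 + y1 * m1) + y0 * (l0 * m1 - l1 * m0)); first by ring.
  by rewrite ym D0; ring.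
by rewrite z0 z1 eqxx; case.
Qed.

(** For a function homogeneous of degree 0, [f_{;1}] vanishes, so that
    [F] times its vertical derivative is [f_{;2} m]. *)
Lemma dy_frame f v i : euler U 0 f -> U v ->
  F v * dy i f v = v2 F m f v * m i v.
Proof.
move=> ef Uv; have D0 := frame_det_neq0 Uv.
have dec j := @frame_decomposition F m (fun i => F v * dy i f v) v j D0.
rewrite /v2; move: (frame_comp _ _ _ _) dec => [a b] /= dec.
suff a0 : a = 0 by rewrite dec a0 mul0r add0r.
have yl := ell_euler FU Uv; have ym := frame_y Uv; have nz := finsler_neq0 FU Uv.
have yf := ef v Uv; rewrite mul0r in yf.
have alg (y0 y1 l0 l1 m0 m1 f0 f1 g : R) : g != 0 ->
  y0 * l0 + y1 * l1 = g -> y0 * m0 + y1 * m1 = 0 -> y0 * f0 + y1 * f1 = 0 ->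
  g * f0 = a * l0 + b * m0 -> g * f1 = a * l1 + b * m1 -> a = 0.
  move=> g0 e1 e2 e3 e4 e5; apply: (mulIf g0); rewrite mul0r -{1}e1.
  transitivity (y0 * (a * l0 + b * m0) + y1 * (a * l1 + b * m1) -
    b * (y0 * m0 + y1 * m1)); first by ring.
  rewrite -e4 -e5 e2; transitivity (g * (y0 * f0 + y1 * f1)); first by ring.
  by rewrite e3 mulr0.
exact (alg _ _ _ _ _ _ _ _ _ nz yl ym yf (dec 0) (dec 1)).
Qed.

(** A covector is proportional to [l] if and only if its [m]-component is 0. *)
Lemma det_ell_frame w v : U v ->
  det_ell F w v = 0 <-> (frame_comp F m w v).2 = 0.
Proof.
move=> Uv; have D0 := frame_det_neq0 Uv.
have dec j := @frame_decomposition F m w v j D0.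
move: (frame_comp _ _ _ _) dec D0 => [a b] /= dec.
rewrite /det_ell /frame_det (dec 0) (dec 1).
move: (dy 0 F v) (dy 1 F v) (m 0 v) (m 1 v) => l0 l1 m0 m1 D0.
have -> : (a * l0 + b * m0) * l1 - (a * l1 + b * m1) * l0 =
  - (b * (l0 * m1 - l1 * m0)) by ring.
split=> [/eqP|->]; last by rewrite mul0r oppr0.
by rewrite oppr_eq0 mulf_eq0 (negbTE D0) orbF => /eqP.
Qed.

(** A covector is proportional to [m] if and only if its [l]-component is 0. *)
Lemma det_frame w v : U v ->
  w 0 * m 1 v = w 1 * m 0 v <-> (frame_comp F m w v).1 = 0.
Proof.
move=> Uv; have D0 := frame_det_neq0 Uv.
have dec j := @frame_decomposition F m w v j D0.
move: (frame_comp _ _ _ _) dec D0 => [a b] /= dec.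
rewrite /frame_det (dec 0) (dec 1).
move: (dy 0 F v) (dy 1 F v) (m 0 v) (m 1 v) => l0 l1 m0 m1 D0.
split=> [e|->]; last by ring.
apply: (mulIf D0); rewrite mul0r.
transitivity ((a * l0 + b * m0) * m1 - (a * l1 + b * m1) * m0); first by ring.
by rewrite e subrr.
Qed.

(** As [m] spans the annihilator of [y], Hamel's equation amounts to
    [G^k m_k = 0]. *)
Lemma spray_m v : U v ->
  spray_coef F 0 v * m 0 v + spray_coef F 1 v * m 1 v = 0 <-> hamel F v = 0.
Proof.
move=> Uv; split=> [Gm|H0]; last first.
  rewrite !(hamel0_spray FU _ Uv H0); move: (dx_y F v / _) => p.
  transitivity (p * (ycomp 0 v * m 0 v + ycomp 1 v * m 1 v)); first by ring.
  by rewrite frame_y // mulr0.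
have yl := ell_euler FU Uv; have ym := frame_y Uv; have nz := finsler_neq0 FU Uv.
have D0 := frame_det_neq0 Uv.
pose p := (spray_coef F 0 v * dy 0 F v + spray_coef F 1 v * dy 1 F v) / F v.
have [] // := @spray_hamel0 _ _ _ FU v p Uv.
move: D0 Gm; rewrite /p /frame_det.
have alg (g0 g1 l0 l1 m0 m1 y0 y1 f : R) :
  f != 0 -> l0 * m1 - l1 * m0 != 0 -> y0 * l0 + y1 * l1 = f -> y0 * m0 + y1 * m1 = 0 ->
  g0 * m0 + g1 * m1 = 0 ->
  g0 = (g0 * l0 + g1 * l1) / f * y0 /\ g1 = (g0 * l0 + g1 * l1) / f * y1.
  move=> f0 D e1 e2 e3.
  have e : g0 * y1 = g1 * y0.
    apply: (mulIf D).
    transitivity ((g0 * l0 + g1 * l1) * (y0 * m0 + y1 * m1) -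
      (g0 * m0 + g1 * m1) * (y0 * l0 + y1 * l1) + g1 * y0 * (l0 * m1 - l1 * m0)).
      by ring.
    by rewrite e2 e3 !(mul0r, mulr0) subr0 add0r.
  split; apply: (mulIf f0); rewrite mulrAC divfK //.
    rewrite -{1}e1; transitivity (g0 * y0 * l0 + g0 * y1 * l1); first by ring.
    by rewrite e; ring.
  rewrite -{1}e1; transitivity (g1 * y0 * l0 + g1 * y1 * l1); first by ring.
  by rewrite -e; ring.
move=> D0 Gm; have [e0 e1] := alg _ _ _ _ _ _ _ _ _ nz D0 yl ym Gm.
exact: ord2P.
Qed.

End Frame.

(** * Anisotropic conformal changes *)

Section ConformalChange.
Context {R : realType}.
Local Notation TR2 := ('rV[R]_2 * 'rV[R]_2)%type.
Implicit Types (f : TR2 -> R) (v : TR2) (i j k : 'I_2).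

Lemma differentiable_expR f v : differentiable f v ->
  differentiable (fun u => expR (f u)) v.
Proof.
move=> df; apply: (@differentiable_comp _ _ _ _ f expR) => //.
exact/derivable1_diffP/derivable_expR.
Qed.

Lemma derive_expR_comp f v (w : TR2) : differentiable f v ->
  'D_w (fun u => expR (f u)) v = expR (f v) * 'D_w f v.
Proof.
move=> df; have de : differentiable (@expR R) (f v).
  exact/derivable1_diffP/derivable_expR.
have dc := differentiable_expR df.
apply: etrans (deriveE w dc) _.
apply: etrans (congr1 (fun h : TR2 -> R => h w) (diff_comp df de)) _.
rewrite /= (deriveE w df).
move: ('d f v w) => a.
have {1}-> : a = a *: (1 : R) by rewrite [RHS]mulr1.
rewrite linearZ /= -deriveE // (@derive_val _ _ _ _ _ _ _ (is_derive_expR (f v))).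
exact: mulrC.
Qed.

Context (U : set TR2) (F phi : TR2 -> R).
Let Fb := aniso_conf F phi.
Context (FU : local_finsler U F) (FbU : local_finsler U Fb).
Context (sphi : smooth_on U phi) (ephi : euler U 0 phi).
Context (eps : R) (m : 'I_2 -> TR2 -> R).
Hypothesis eps_neq0 : eps != 0.
Hypothesis frame_metric : forall v i j, U v ->
  metric F v i j = ell F i v * ell F j v + eps * m i v * m j v.
Hypothesis proper : forall v, U v -> v2 F m phi v != 0.
Let oU := lf_open FU.
Let sF := lf_smooth FU.
Let D0 v := frame_det_neq0 FU eps_neq0 frame_metric (v := v).

Lemma derive_aniso_conf v (w : TR2) : U v ->
  'D_w Fb v = expR (phi v) * ('D_w F v + F v * 'D_w phi v).
Proof.
move=> Uv; have dF := smooth_on_differentiable sF Uv.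
have dp := smooth_on_differentiable sphi Uv.
apply: etrans (deriveM_fun w (differentiable_expR dp) dF) _.
apply: etrans (congr1 (fun a => expR (phi v) * 'D_w F v + F v * a)
  (derive_expR_comp w dp)) _.
have alg (e a f b : R) : e * a + f * (e * b) = e * (a + f * b) by ring.
exact: alg.
Qed.

(** The covector [l] of [e^phi F] is [e^phi (l + phi_{;2} m)]. *)
Lemma ell_conf v i : U v ->
  dy i Fb v = expR (phi v) * (dy i F v + v2 F m phi v * m i v).
Proof.
move=> Uv; rewrite -(dy_frame FU eps_neq0 frame_metric i ephi Uv).
exact (derive_aniso_conf _ Uv).
Qed.

(** The determinant vanishes if and only if [w] is proportional to
    [l + phi_{;2} m]. *)
Lemma det_ell_conf (w : 'I_2 -> R) v : U v ->
  det_ell Fb w v = 0 <->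
  (frame_comp F m w v).2 = v2 F m phi v * (frame_comp F m w v).1.
Proof.
move=> Uv; have D := D0 Uv.
have dec j := @frame_decomposition R F m w v j D.
rewrite /det_ell (ell_conf 0 Uv) (ell_conf 1 Uv).
move: (frame_comp _ _ _ _) dec D => [a b] /= dec.
rewrite (dec 0) (dec 1) /frame_det.
have e0 : expR (phi v) != 0 by rewrite gt_eqF ?expR_gt0.
move: (dy 0 F v) (dy 1 F v) (m 0 v) (m 1 v) (v2 F m phi v) (expR (phi v)) e0.
move=> l0 l1 m0 m1 s e e0 D.
have -> : (a * l0 + b * m0) * (e * (l1 + s * m1)) -
   (a * l1 + b * m1) * (e * (l0 + s * m0)) =
   (s * a - b) * (e * (l0 * m1 - l1 * m0)) by ring.
split=> [/eqP|->]; last by rewrite subrr mul0r.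
by rewrite mulf_eq0 (negbTE (mulf_neq0 e0 D)) orbF subr_eq0 => /eqP.
Qed.

(** A covector proportional to both [l] and [l + phi_{;2} m] is 0, as
    [phi_{;2}] is not 0. *)
Lemma both_anisotropic v i : U v ->
  det_ell F (fun j => dx j phi v) v = 0 ->
  det_ell Fb (fun j => dx j phi v) v = 0 -> dx i phi v = 0.
Proof.
move=> Uv /(det_ell_frame FU eps_neq0 frame_metric _ Uv) b0.
move=> /(det_ell_conf _ Uv); rewrite b0 => /esym/eqP.
rewrite mulf_eq0 (negbTE (proper Uv)) /= => /eqP a0.
rewrite (@frame_decomposition R F m (fun j => dx j phi v) v i (D0 Uv)).
by rewrite a0 b0 !mul0r addr0.
Qed.

(** Where the [partial_i phi] vanish, [S(phi)] is
    [- 2 phi_{;2} (G^k m_k) / F]. *)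
Lemma spray_first_integral v : U v -> (forall i, dx i phi v = 0) ->
  spray F phi v = 0 <-> hamel F v = 0.
Proof.
move=> Uv dx0; rewrite -(spray_m FU eps_neq0 frame_metric Uv).
rewrite /spray (sum2 (fun i => ycomp i v * dx i phi v)).
rewrite (sum2 (fun i => spray_coef F i v * dy i phi v)).
have nz := finsler_neq0 FU Uv; have pz := proper Uv.
have e i := dy_frame FU eps_neq0 frame_metric i ephi Uv.
have alg (f s g0 g1 d0 d1 m0 m1 y0 y1 x0 x1 : R) : f != 0 -> s != 0 ->
  f * d0 = s * m0 -> f * d1 = s * m1 -> x0 = 0 -> x1 = 0 ->
  y0 * x0 + y1 * x1 - 2 * (g0 * d0 + g1 * d1) = 0 <-> g0 * m0 + g1 * m1 = 0.
  move=> f0 s0 e0 e1 -> ->; rewrite !mulr0 addr0 sub0r.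
  have E : f * (g0 * d0 + g1 * d1) = s * (g0 * m0 + g1 * m1).
    transitivity (g0 * (f * d0) + g1 * (f * d1)); first by ring.
    by rewrite e0 e1; ring.
  split=> [/eqP|h].
    rewrite oppr_eq0 mulf_eq0 pnatr_eq0 /= => /eqP h.
    by apply: (mulfI s0); rewrite -E h !mulr0.
  have -> : g0 * d0 + g1 * d1 = 0 by apply: (mulfI f0); rewrite E h !mulr0.
  by rewrite mulr0 oppr0.
exact (alg _ _ _ _ _ _ _ _ _ _ _ _ nz pz (e 0) (e 1) (dx0 0) (dx0 1)).
Qed.

(** The factor [P = y^r partial_r F / (2 F)] of a flat spray [G^i = P y^i]. *)
Definition proj_factor v : R := dx_y F v * (2 * F v)^-1.

Lemma differentiable_proj_factor v : U v -> differentiable proj_factor v.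
Proof.
move=> Uv.
have dxF r : differentiable (dx r F) v.
  exact: (smooth_on_differentiable (smooth_on_dx r sF) Uv).
have dF := smooth_on_differentiable sF Uv.
have dp r : differentiable (fun u => ycomp r u * dx r F u) v.
  by apply: differentiableM_fun; [exact: differentiable_ycomp|exact: dxF].
have d2 : differentiable (fun u => 2 * F u) v.
  exact: (differentiableM_fun (differentiable_cst (2 : R) v) dF).
have nz : 2 * F v != 0 by rewrite mulf_neq0 ?pnatr_eq0 ?(finsler_neq0 FU Uv).
exact: (differentiableM_fun (differentiableD_fun (dp 0) (dp 1)) (differentiableV d2 nz)).
Qed.

Section Flat.
Hypothesis flat : forall v, U v -> hamel F v = 0.

Lemma connection_flat v i j : U v ->
  connection F j i v = ycomp j v * dy i proj_factor v + proj_factor v * (j == i)%:R.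
Proof.
move=> Uv; have dP := differentiable_proj_factor Uv.
have dyc := differentiable_ycomp j v.
apply: etrans (derive_eq_open ((0, delta_mx 0 i) : TR2) oU Uv
  (fun u Uu => hamel0_spray FU j Uu (flat Uu))) _.
apply: etrans (deriveM_fun _ dP dyc) _.
rewrite addrC.
exact (congr1 (fun a => ycomp j v * dy i proj_factor v + proj_factor v * a)
  (dy_ycomp j i v)).
Qed.

Lemma spray_ell_flat v : U v ->
  (\sum_k spray_coef F k v * ell F k v) / F v ^+ 2 = proj_factor v / F v.
Proof.
move=> Uv; have nz := finsler_neq0 FU Uv; have yl := ell_euler FU Uv.
have G i : spray_coef F i v = proj_factor v * ycomp i v.
  exact (hamel0_spray FU i Uv (flat Uv)).
rewrite sum2 (G 0) (G 1).
have alg (p y0 y1 l0 l1 f : R) : f != 0 -> y0 * l0 + y1 * l1 = f ->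
  (p * y0 * l0 + p * y1 * l1) / f ^+ 2 = p / f.
  move=> f0 e; have -> : p * y0 * l0 + p * y1 * l1 = p * f by rewrite -e; ring.
  by field.
exact (alg _ _ _ _ _ _ nz yl).
Qed.

Lemma hderive_flat v i : U v ->
  hderive F i phi v =
  dx i phi v - v2 F m phi v * (proj_factor v / F v) * m i v.
Proof.
move=> Uv; rewrite /hderive sum2 (connection_flat i 0 Uv) (connection_flat i 1 Uv).
have nz := finsler_neq0 FU Uv; have e := dy_frame FU eps_neq0 frame_metric i ephi Uv.
have ey := ephi Uv; rewrite mul0r in ey.
have K : (0 == i)%:R * dy 0 phi v + (1 == i)%:R * dy 1 phi v = dy i phi v.
  by move: i {e}; apply: ord2P; rewrite eqxx ?mul1r ?mul0r ?addr0 ?add0r.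
have alg (x y0 y1 q p z0 z1 d0 d1 d f s n : R) : f != 0 -> f * d = s * n ->
  y0 * d0 + y1 * d1 = 0 -> z0 * d0 + z1 * d1 = d ->
  x - ((y0 * q + p * z0) * d0 + (y1 * q + p * z1) * d1) = x - s * (p / f) * n.
  move=> f0 e1 e2 e3; congr (_ - _).
  transitivity (q * (y0 * d0 + y1 * d1) + p * (z0 * d0 + z1 * d1)); first by ring.
  rewrite e2 e3 mulr0 add0r; apply: (mulfI f0).
  transitivity (p * (f * d)); first by ring.
  by rewrite e1; field.
exact (alg _ _ _ _ _ _ _ _ _ _ _ _ _ nz e ey K).
Qed.

(** For a flat metric, [phi_{,1}] and [phi_{,2}] are the components of
    [partial phi], the second one shifted by [- phi_{;2} G^k l_k / F^2]. *)
Lemma horizontal_flat v : U v ->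
  h1 F m phi v = (frame_comp F m (fun i => dx i phi v) v).1 /\
  h2 F m phi v = (frame_comp F m (fun i => dx i phi v) v).2 -
    v2 F m phi v * (proj_factor v / F v).
Proof.
move=> Uv; have D := D0 Uv.
have dec j := @frame_decomposition R F m (fun i => dx i phi v) v j D.
rewrite /h1 /h2.
move: (frame_comp F m (fun i => dx i phi v) v) dec => [a b] /= dec.
rewrite (@frame_compE R F m _ v a (b - v2 F m phi v * (proj_factor v / F v)) D) //.
move=> i; rewrite (hderive_flat i Uv) (dec i).
have alg (x y s n : R) : x + y * n - s * n = x + (y - s) * n by ring.
exact: alg.
Qed.

End Flat.

Section Minkowski.
Hypothesis minkowski : forall v i, U v -> spray_coef F i v = 0.
Hypothesis sm : forall i, smooth_on U (m i).
Hypothesis aniso : forall v, U v -> det_ell Fb (fun i => dx i phi v) v = 0.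

Let dxF0 k v : U v -> dx k F v = 0.
Proof. by move=> Uv; apply: (minkowski_dx FU k _ Uv) => u i Uu; exact: minkowski. Qed.

(** The frame of a metric independent of [x] does not depend on [x]. *)
Lemma minkowski_dx_frame k i v : U v -> dx k (m i) v = 0.
Proof.
move=> Uv; pose w : TR2 := (delta_mx 0 k, 0).
have dm j : differentiable (m j) v := smooth_on_differentiable (sm j) Uv.
have dF1 j : differentiable (dy j F) v := smooth_on_differentiable (smooth_on_dy j sF) Uv.
have dF2 a b : differentiable (dy a (dy b F)) v :=
  smooth_on_differentiable (smooth_on_dy a (smooth_on_dy b sF)) Uv.
have dF := smooth_on_differentiable sF Uv.
have x1 u j : U u -> dx k (dy j F) u = 0.
  move=> Uu; apply: etrans (dx_dy_sym k j oU sF Uu) _.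
  apply: etrans (derive_eq_open _ oU Uu (fun z Uz => dxF0 k Uz)) _.
  exact: derive_cst.
have x2 a b : dx k (dy a (dy b F)) v = 0.
  apply: etrans (dx_dy_sym k a oU (smooth_on_dy b sF) Uv) _.
  apply: etrans (derive_eq_open _ oU Uv (fun z Uz => x1 z b Uz)) _.
  exact: derive_cst.
have E a b u : U u -> eps * (m a u * m b u) = F u * dy a (dy b F) u.
  move=> Uu; have := frame_metric a b Uu; rewrite (metricE a b oU sF Uu) => /addrI ->.
  by rewrite mulrA.
have e a b : m a v * dx k (m b) v + m b v * dx k (m a) v = 0.
  have dmm := differentiableM_fun (dm a) (dm b).
  have l := etrans (deriveM_fun w (differentiable_cst eps v) dmm)
    (congr2 (fun p q => eps * p + m a v * m b v * q) (deriveM_fun w (dm a) (dm b))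
      (derive_cst eps v w)).
  have r := etrans (deriveM_fun w dF (dF2 a b))
    (congr2 (fun p q => F v * p + dy a (dy b F) v * q) (x2 a b) (dxF0 k Uv)).
  have := etrans (esym l) (etrans (derive_eq_open w oU Uv (E a b)) r).
  rewrite !mulr0 !addr0 => z.
  by apply: (mulfI eps_neq0); rewrite mulr0; exact: z.
(* Only one of [m_0], [m_1] need be nonzero: it gives its own derivative first,
   then the derivative of the other. *)
have two (p q : R) : p != 0 -> p * q + p * q = 0 -> q = 0.
  move=> p0 /eqP; rewrite -mulr2n mulrn_eq0 /= mulf_eq0 (negbTE p0) /=.
  by move=> /eqP.
have mix (p q r s : R) : p != 0 -> s = 0 -> p * r + q * s = 0 -> r = 0.
  move=> p0 -> /eqP; rewrite mulr0 addr0 mulf_eq0 (negbTE p0) /=.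
  by move=> /eqP.
have [n0|n1] := frame_neq0 FU frame_metric Uv.
  have z0 := two _ _ n0 (e 0 0); have z1 := mix _ _ _ _ n0 z0 (e 0 1).
  by move: i; apply: ord2P.
have z1 := two _ _ n1 (e 1 1); have z0 := mix _ _ _ _ n1 z1 (e 1 0).
by move: i; apply: ord2P.
Qed.

(* A closed form of [phi_{;2}] on [U], whose differentiability is apparent. *)
Let psi u : R := F u * (dy 0 F u * dy 1 phi u - dy 1 F u * dy 0 phi u) *
  (frame_det F m u)^-1.

Let psiE u : U u -> v2 F m phi u = psi u.
Proof.
move=> Uu; have e i := dy_frame FU eps_neq0 frame_metric i ephi Uu.
move: (D0 Uu); rewrite /psi /frame_det.
have alg (s f l0 l1 m0 m1 d0 d1 : R) : f * d0 = s * m0 -> f * d1 = s * m1 ->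
  l0 * m1 - l1 * m0 != 0 -> s = f * (l0 * d1 - l1 * d0) / (l0 * m1 - l1 * m0).
  move=> e0 e1 D.
  have -> : f * (l0 * d1 - l1 * d0) = l0 * (f * d1) - l1 * (f * d0) by ring.
  by rewrite e0 e1; field.
exact (alg _ _ _ _ _ _ _ _ (e 0) (e 1)).
Qed.

Let differentiable_psi v : U v -> differentiable psi v.
Proof.
move=> Uv.
have dm j : differentiable (m j) v := smooth_on_differentiable (sm j) Uv.
have dF1 j : differentiable (dy j F) v := smooth_on_differentiable (smooth_on_dy j sF) Uv.
have dp1 j : differentiable (dy j phi) v :=
  smooth_on_differentiable (smooth_on_dy j sphi) Uv.
have dF := smooth_on_differentiable sF Uv.
have dD : differentiable (frame_det F m) v.
  exact: (differentiableB_fun (differentiableM_fun (dF1 0) (dm 1))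
    (differentiableM_fun (dF1 1) (dm 0))).
have dn := differentiableB_fun (differentiableM_fun (dF1 0) (dp1 1))
    (differentiableM_fun (dF1 1) (dp1 0)).
exact: (differentiableM_fun (differentiableM_fun dF dn) (differentiableV dD (D0 Uv))).
Qed.

Let psi_dx v k i : U v ->
  F v * dx k (dy i phi) v = dx k (v2 F m phi) v * m i v.
Proof.
move=> Uv; pose w : TR2 := (delta_mx 0 k, 0).
have dF := smooth_on_differentiable sF Uv.
have dp := smooth_on_differentiable (smooth_on_dy i sphi) Uv.
have dm := smooth_on_differentiable (sm i) Uv.
have E u : U u -> F u * dy i phi u = psi u * m i u.
  by move=> Uu; rewrite -psiE //; exact: (dy_frame FU eps_neq0 frame_metric i ephi Uu).
have q : dx k (v2 F m phi) v = dx k psi v := derive_eq_open w oU Uv psiE.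
have l := etrans (deriveM_fun w dF dp)
  (congr1 (fun a => F v * dx k (dy i phi) v + dy i phi v * a) (dxF0 k Uv)).
have r := etrans (deriveM_fun w (differentiable_psi Uv) dm)
  (congr1 (fun a => psi v * a + m i v * dx k psi v) (minkowski_dx_frame k i Uv)).
have := etrans (esym l) (etrans (derive_eq_open w oU Uv E) r).
rewrite q !mulr0 addr0 add0r => e.
by rewrite [RHS]mulrC; exact: e.
Qed.

(** Since [partial_k (e^phi F) = e^phi F partial_k phi], the remaining terms form
    the determinant of [partial phi] and of the covector [l] of [e^phi F], which
    vanishes by assumption. *)
Lemma hamel_conf v : U v ->
  hamel Fb v = Fb v * (dx 1 (dy 0 phi) v - dx 0 (dy 1 phi) v).
Proof.
move=> Uv.
have dFb := smooth_on_differentiable (lf_smooth FbU) Uv.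
have dp k : differentiable (dx k phi) v :=
  smooth_on_differentiable (smooth_on_dx k sphi) Uv.
have dxFb k u : U u -> dx k Fb u = Fb u * dx k phi u.
  move=> Uu; apply: etrans (derive_aniso_conf _ Uu) _.
  apply: etrans (congr1 (fun a => expR (phi u) * (a + F u * dx k phi u)) (dxF0 k Uu)) _.
  have alg (e f d : R) : e * (0 + f * d) = e * f * d by ring.
  exact: alg.
have h i k : dy i (dx k Fb) v = Fb v * dx k (dy i phi) v + dx k phi v * dy i Fb v.
  apply: etrans (derive_eq_open _ oU Uv (dxFb k)) _.
  apply: etrans (deriveM_fun _ dFb (dp k)) _.
  exact (congr1 (fun a => Fb v * a + dx k phi v * dy i Fb v)
    (esym (dx_dy_sym k i oU sphi Uv))).
rewrite /hamel (h 0 1) (h 1 0).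
have alg (f a b p q r s : R) : q * r - p * s = 0 ->
  f * a + p * s - (f * b + q * r) = f * (a - b).
  move=> e; transitivity (f * (a - b) - (q * r - p * s)); first by ring.
  by rewrite e subr0.
exact (alg _ _ _ _ _ _ _ (aniso Uv)).
Qed.

(** With [F] and [m] independent of [x], [F partial_k] of the vertical derivative
    of [phi] is [partial_k (phi_{;2}) m], so that Hamel's equation for [e^phi F]
    says that [partial (phi_{;2})] is proportional to [m]. *)
Lemma minkowski_h1 v : U v ->
  hamel Fb v = 0 <-> h1 F m (v2 F m phi) v = 0.
Proof.
move=> Uv; have nz := finsler_neq0 FU Uv; have nzb := finsler_neq0 FbU Uv.
have hE : (fun i => hderive F i (v2 F m phi) v) = (fun i => dx i (v2 F m phi) v).
  apply/funext => i; rewrite /hderive sum2.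
  have c j : connection F j i v = 0.
    apply: etrans (derive_eq_open ((0, delta_mx 0 i) : TR2) oU Uv
      (fun u Uu => minkowski j Uu)) _.
    exact: derive_cst.
  rewrite (c 0) (c 1).
  have alg (x a b : R) : x - (0 * a + 0 * b) = x by ring.
  exact: alg.
rewrite /h1 hE -(det_frame FU eps_neq0 frame_metric _ Uv) (hamel_conf Uv).
have p01 := psi_dx 0 1 Uv; have p10 := psi_dx 1 0 Uv.
have alg (f fb a b p q m0 m1 : R) : f != 0 -> fb != 0 ->
  f * a = p * m1 -> f * b = q * m0 -> fb * (b - a) = 0 <-> p * m1 = q * m0.
  move=> f0 fb0 <- <-; split=> [/eqP|/(mulfI f0) ->]; last by rewrite subrr mulr0.
  by rewrite mulf_eq0 (negbTE fb0) subr_eq0 /= => /eqP ->.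
exact (alg _ _ _ _ _ _ _ _ nz nzb p01 p10).
Qed.

End Minkowski.

End ConformalChange.

(** * From charts to the surface *)

Section Surface.
Context {R : realType} {M : surface R}.
Local Notation TR2 := ('rV[R]_2 * 'rV[R]_2)%type.
Implicit Types (A : tset R M) (F phi : tfun R M) (eps : R).
Implicit Types m : chart R M -> 'I_2 -> TR2 -> R.

Lemma euler_chart A (r : nat) (f : tfun R M) c : conic_subbundle A ->
  smooth_function_on A f -> homogeneous_on A r f -> atlas c ->
  euler (A c) r%:R (f c).
Proof.
move=> cA [_ sf] hf ac; apply: euler_homogeneous.
- exact: (csb_open cA ac).
- exact: sf.
- by move=> v lambda Av l0; exact: hf.
Qed.

Lemma finsler_chart A F c : conic_subbundle A -> conic_pseudo_finsler A F ->
  atlas c -> local_finsler (A c) (F c).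
Proof.
move=> cA fF ac; split.
- exact: (csb_open cA ac).
- by move=> v Av; have [] := csb_sub cA ac Av.
- exact: ((cpf_smooth fF).2 c ac).
- exact: (euler_chart cA (cpf_smooth fF) (cpf_homogeneous fF) ac).
- by move=> v Av; exact: (cpf_nondegenerate fF ac Av).
Qed.

Lemma projectively_flat_hamel A F c :
  projectively_flat A F c <-> forall v, A c v -> hamel (F c) v = 0.
Proof.
split=> h v Av; first by apply/eqP; rewrite subr_eq0; apply/eqP; exact: h.
by apply/eqP; rewrite -subr_eq0; apply/eqP; exact: h.
Qed.

(** When [G^i = 0], projective equivalence says that the second spray is
    proportional to [y]. *)
Lemma projectively_equivalent_minkowski A F F' c :
  local_finsler (A c) (F' c) -> minkowski_coordinates A F c ->
  projectively_equivalent A F F' c <-> forall v, A c v -> hamel (F' c) v = 0.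
Proof.
move=> FU' mF; split=> [[P GP] v Av|H].
  have [] // := spray_hamel0 (p := P v) FU' Av.
  by move=> i; rewrite GP // mF // add0r.
exists (fun v => dx_y (F' c) v / (2 * F' c v)) => v i Av.
by rewrite (mF _ _ Av) add0r (hamel0_spray FU' _ Av (H v Av)).
Qed.

(** For a metric that is Riemannian on no open set, [C^i_{jk} partial_i phi = 0]
    means that [partial phi] is proportional to [l]. *)
Lemma cartan_anisotropic_det A F phi m c : atlas c ->
  local_finsler (A c) (F c) -> smooth_on (A c) (phi c) ->
  non_riemannian A F m ->
  (forall v, A c v -> m c 0 v != 0 \/ m c 1 v != 0) ->
  cartan_anisotropic A F phi c <->
  forall v, A c v -> det_ell (F c) (fun i => dx i (phi c) v) v = 0.
Proof.
move=> ac FU sphi nF mn; apply: (cartan_aniso_iff FU sphi) => V oV VA V0.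
have [v Vv Iv] := nF c V ac oV VA V0; exists v => //.
exact: (main_scalar_neq0 (mn v (VA v Vv)) Iv).
Qed.

Lemma change_frame_neq0 A eps F m phi c v : atlas c -> A c v ->
  same_frame_sign A eps F m phi ->
  m c 0 v != 0 \/ m c 1 v != 0 ->
  change_frame eps F m phi c 0 v != 0 \/ change_frame eps F m phi c 1 v != 0.
Proof.
move=> ac Av sgn mn; have s0 := sgn c v ac Av.
have k0 : expR (phi c v) * Num.sqrt (eps / ac_rho eps (F c) (m c) (phi c) v) != 0.
  by rewrite mulf_neq0 // gt_eqF ?expR_gt0 ?sqrtr_gt0.
by case: mn => mn; [left|right]; exact: (mulf_neq0 k0 mn).
Qed.

End Surface.

Theorem proposition3p6 (R : realType) (M : surface R) (A : tset R M)
    (F phi : tfun R M) (eps : R)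
    (m : chart R M -> 'I_2 -> 'rV[R]_2 * 'rV[R]_2 -> R) :
  conic_subbundle A ->
  (eps = 1 \/ eps = -1) ->
  conic_pseudo_finsler A F ->
  modified_berwald_frame A eps F m ->
  aniso_conformal_factor A eps F m phi ->
  proper_change A F m phi ->
  same_frame_sign A eps F m phi ->
  conic_pseudo_finsler A (change_metric F phi) ->
  non_riemannian A F m ->
  non_riemannian A (change_metric F phi) (change_frame eps F m phi) ->
  [/\ (* (i) *)
      forall c, atlas c -> minkowski_coordinates A F c ->
        cartan_anisotropic A (change_metric F phi) phi c ->
        (projectively_equivalent A F (change_metric F phi) c <->
         forall v, A c v -> h1 (F c) (m c) (v2 (F c) (m c) (phi c)) v = 0),
      (* (ii) *)
      forall c, atlas c -> projectively_flat A F c ->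
        (cartan_anisotropic A (change_metric F phi) phi c <->
         forall v, A c v -> h2 (F c) (m c) (phi c) v =
           v2 (F c) (m c) (phi c) v *
             (h1 (F c) (m c) (phi c) v - spray_ell F c v)) /\
        (cartan_anisotropic A F phi c <->
         forall v, A c v -> h2 (F c) (m c) (phi c) v =
           - v2 (F c) (m c) (phi c) v * spray_ell F c v) &
      (* (iii) *)
      forall c, atlas c -> cartan_anisotropic A F phi c ->
        cartan_anisotropic A (change_metric F phi) phi c ->
        (projectively_flat A F c <-> first_integral A F phi c)].
Proof.
move=> cA eps1 fF frm [sphi hphi _] prop sgn fFb nF nFb.
have eps0 : eps != 0 by case: eps1 => ->; rewrite ?oppr_eq0 oner_neq0.
have FU c (ac : atlas c) := finsler_chart cA fF ac.
have FbU c (ac : atlas c) : local_finsler (A c) (aniso_conf (F c) (phi c)) :=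
  finsler_chart cA fFb ac.
have sp c (ac : atlas c) : smooth_on (A c) (phi c) := sphi.2 c ac.
have ep c (ac : atlas c) : euler (A c) 0 (phi c) := euler_chart cA sphi hphi ac.
have sm c (ac : atlas c) i : smooth_on (A c) (m c i) := (frm c ac).1 i.
have fm c (ac : atlas c) v i j (Av : A c v) := (frm c ac).2 v i j Av.
have pr c (ac : atlas c) v (Av : A c v) := prop c v ac Av.
have mn c (ac : atlas c) v (Av : A c v) := frame_neq0 (FU c ac) (fm c ac) Av.
have C c (ac : atlas c) := cartan_anisotropic_det ac (FU c ac) (sp c ac) nF (mn c ac).
have Cb c (ac : atlas c) := cartan_anisotropic_det ac (FbU c ac) (sp c ac) nFb
  (fun v Av => change_frame_neq0 ac Av sgn (mn c ac v Av)).
split=> c ac.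
- move=> mink /(Cb c ac) aniso.
  have h1E v (Av : A c v) := minkowski_h1 (FU c ac) (FbU c ac) (sp c ac) (ep c ac)
    eps0 (fm c ac) (fun u i Au => mink u i Au) (sm c ac) aniso Av.
  apply: iff_trans (projectively_equivalent_minkowski (FbU c ac) mink) _.
  by split=> h v Av; apply/(h1E v Av); exact: h.
- move=> /projectively_flat_hamel flat.
  have hor v (Av : A c v) := horizontal_flat (FU c ac) (ep c ac) eps0 (fm c ac) flat Av.
  have se v (Av : A c v) : spray_ell F c v = proj_factor (F c) v / F c v :=
    spray_ell_flat (FU c ac) flat Av.
  split.
    apply: iff_trans (Cb c ac) _; split=> h v Av.
      have [-> ->] := hor v Av; rewrite se //.
      have /(det_ell_conf (FU c ac) (sp c ac) (ep c ac) eps0 (fm c ac) _ Av) -> := h v Av.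
      by rewrite mulrBr.
    apply/(det_ell_conf (FU c ac) (sp c ac) (ep c ac) eps0 (fm c ac) _ Av).
    have := h v Av; have [-> ->] := hor v Av; rewrite se // mulrBr.
    exact: addIr.
  apply: iff_trans (C c ac) _; split=> h v Av.
    have [_ ->] := hor v Av; rewrite se //.
    have /(det_ell_frame (FU c ac) eps0 (fm c ac) _ Av) -> := h v Av.
    by rewrite sub0r mulNr.
  apply/(det_ell_frame (FU c ac) eps0 (fm c ac) _ Av).
  have := h v Av; have [_ ->] := hor v Av; rewrite se // mulNr -[RHS]sub0r.
  exact: addIr.
move=> /(C c ac) c1 /(Cb c ac) c2.
apply: iff_trans (projectively_flat_hamel A F c) _.
have dx0 v (Av : A c v) i : dx i (phi c) v = 0 := both_anisotropic (FU c ac)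
  (sp c ac) (ep c ac) eps0 (fm c ac) (pr c ac) i Av (c1 v Av) (c2 v Av).
have si v (Av : A c v) := spray_first_integral (FU c ac) (ep c ac) eps0 (fm c ac)
  (pr c ac) Av (dx0 v Av).
by split=> h v Av; apply/(si v Av); exact: h.
Qed.
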